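(* Let $\alpha\in(0,1)$, let $D\subset\mathbb{R}^d$ be open with $0\in D$, and let $f:D\to\mathbb{R}^d$ satisfy $f(0)=0$ and be locally Lipschitz continuous in a neighborhood of the origin. Consider the fractional system \[ {}^{C}D^\alpha_{0+}x(t)=f(x(t)),\quad t>0. \tag{$*$} \] Assume there is a function $V:\mathbb{R}^d\to\mathbb{R}_+$ such that (V.i) $V$ is convex and differentiable on $\mathbb{R}^d$; (V.ii) there exist constants $a,b,C_1,C_2,r>0$ with $B_r(0)\subset D$ such that $C_1\|x\|^a\le V(x)\le C_2\|x\|^b$ for all $x\in B_r(0)$; (V.iii) there are constants $C_3\ge 0$ and $c\ge b$ such that $\langle\nabla V(x),f(x)\rangle\le -C_3\|x\|^c$ for all $x\in B_r(0)$. Then: (a) if $C_3=0$, the trivial solution of $( * )$ is stable; (b) if $C_3>0$ (and $c\ge b$), the trivial solution of $( * )$ is asymptotically stable.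
   Context: Riemann--Liouville integral: $I^\alpha_{0+}x(t)=\frac{1}{\Gamma(\alpha)}\int_0^t(t-\tau)^{\alpha-1}x(\tau)\,d\tau$; Caputo derivative: ${}^{C}D^\alpha_{0+}x(t)=\frac{d}{dt}I^{1-\alpha}_{0+}(x-x(0))(t)$, componentwise for vector functions. A solution of $( * )$ with $x(0)=x_0$ on $[0,T)$ is a continuous function $x$ with values in $D$ satisfying ${}^{C}D^\alpha_{0+}x=f(x)$ there (equivalently $x(t)=x_0+I^\alpha_{0+}(f\circ x)(t)$). For $x_0$ near $0$ the initial value problem has a unique solution $\varphi(\cdot,x_0)$ on a maximal interval $[0,t_{\max}(x_0))$, $0<t_{\max}(x_0)\le\infty$. $B_r(0)$ denotes the closed ball of radius $r$ centered at $0$ in $\mathbb{R}^d$ with the Euclidean norm $\|\cdot\|$. The trivial solution is stable if for every $\varepsilon>0$ there is $\delta>0$ such that $\|x_0\|<\delta$ implies $t_{\max}(x_0)=\infty$ and $\|\varphi(t,x_0)\|<\varepsilon$ for all $t\ge0$; it is asymptotically stable if it is stable and there is $\hat\delta>0$ such that $\lim_{t\to\infty}\varphi(t,x_0)=0$ whenever $\|x_0\|<\hat\delta$. *)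

(* Defs.v *)
From Stdlib Require Import Arith Factorial Reals Lra Classical ClassicalEpsilon.
From Stdlib Require Fin.
Open Scope R_scope.

Definition vec (d : nat) := Fin.t d -> R.

Fixpoint fsum (d : nat) : (Fin.t d -> R) -> R :=
  match d with
  | O => fun _ => 0
  | S n => fun g => g Fin.F1 + fsum n (fun i => g (Fin.FS i))
  end.

Definition vzero {d} : vec d := fun _ => 0.
Definition vadd {d} (x y : vec d) : vec d := fun i => x i + y i.
Definition vsub {d} (x y : vec d) : vec d := fun i => x i - y i.
Definition vscal {d} (l : R) (x : vec d) : vec d := fun i => l * x i.
Definition dot {d} (x y : vec d) : R := fsum d (fun i => x i * y i).
Definition norm {d} (x : vec d) : R := sqrt (dot x x).

(** real power with 0^p = 0 (used only for p > 0) *)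
Definition rpow (x p : R) : R := if Rle_dec x 0 then 0 else Rpower x p.

(** Euler's Gamma function via Gauss' limit formula
    Gamma(a) = lim n! n^a / (a (a+1) ... (a+n))   (a > 0). *)
Definition Gamma_seq (a : R) (n : nat) : R :=
  INR (fact n) * Rpower (INR n) a / prod_f_R0 (fun k => a + INR k) n.
Definition Gamma (a : R) : R :=
  epsilon (inhabits 0) (fun g => Un_cv (Gamma_seq a) g).

Definition sing_int (beta : R) (g : R -> R) (t w : R) : Prop :=
  forall eps, 0 < eps -> exists del, 0 < del /\
    forall s, 0 <= s < t -> t - del < s ->
      exists pr : Riemann_integrable
                    (fun tau => Rpower (t - tau) (beta - 1) * g tau) 0 s,
        Rabs (RiemannInt pr - w) < eps.

Definition RL_int (beta : R) (g : R -> R) (t v : R) : Prop :=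
  (t = 0 /\ v = 0) \/
  (0 < t /\ exists w, sing_int beta g t w /\ v = w / Gamma beta).

(** x is a solution of C D^alpha x = f(x), x(0) = x0, on [0,T):
    continuous, with values in D, and x(t) = x0 + I^alpha (f o x)(t)
    componentwise. *)
Definition is_solution {d} (alpha : R) (D : vec d -> Prop) (f : vec d -> vec d)
    (x0 : vec d) (T : R) (x : R -> vec d) : Prop :=
  0 < T /\
  (forall t, 0 <= t < T -> forall eps, 0 < eps -> exists del, 0 < del /\
      forall s, 0 <= s < T -> Rabs (s - t) < del -> norm (vsub (x s) (x t)) < eps) /\
  (forall t, 0 <= t < T -> D (x t)) /\
  (forall t, 0 <= t < T -> forall i : Fin.t d,
      RL_int alpha (fun s => f (x s) i) t (x t i - x0 i)).

Definition is_global_solution {d} (alpha : R) (D : vec d -> Prop)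
    (f : vec d -> vec d) (x0 : vec d) (x : R -> vec d) : Prop :=
  forall T, 0 < T -> is_solution alpha D f x0 T x.

(** Stability of the trivial solution.  Since solutions near 0 are unique,
    "t_max(x0) = infinity and ||phi(t,x0)|| < eps for t >= 0" is expressed as:
    a global solution exists, and every solution (on any [0,T)) stays in the
    eps-ball. *)
Definition stable {d} (alpha : R) (D : vec d -> Prop) (f : vec d -> vec d) : Prop :=
  forall eps, 0 < eps -> exists del, 0 < del /\
    forall x0 : vec d, norm x0 < del ->
      (exists x, is_global_solution alpha D f x0 x) /\
      (forall T x, is_solution alpha D f x0 T x ->
         forall t, 0 <= t < T -> norm (x t) < eps).

Definition asymptotically_stable {d} (alpha : R) (D : vec d -> Prop)
    (f : vec d -> vec d) : Prop :=
  stable alpha D f /\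
  exists dhat, 0 < dhat /\
    forall x0 : vec d, norm x0 < dhat ->
      (exists x, is_global_solution alpha D f x0 x) /\
      (forall x, is_global_solution alpha D f x0 x ->
         forall eps, 0 < eps -> exists M, forall t, M <= t -> norm (x t) < eps).

Definition is_open {d} (D : vec d -> Prop) : Prop :=
  forall x, D x -> exists rho, 0 < rho /\
    forall y, norm (vsub y x) < rho -> D y.

(** f is Lipschitz on some (closed) ball around 0 contained in D
    (equivalently: locally Lipschitz in a neighbourhood of 0). *)
Definition loc_lipschitz_near0 {d} (D : vec d -> Prop) (f : vec d -> vec d) : Prop :=
  exists rho L, 0 < rho /\ 0 <= L /\
    (forall x, norm x <= rho -> D x) /\
    forall x y, norm x <= rho -> norm y <= rho ->
      norm (vsub (f x) (f y)) <= L * norm (vsub x y).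

Definition convex {d} (V : vec d -> R) : Prop :=
  forall x y l, 0 <= l <= 1 ->
    V (vadd (vscal l x) (vscal (1 - l) y)) <= l * V x + (1 - l) * V y.

Definition has_gradient {d} (V : vec d -> R) (x g : vec d) : Prop :=
  forall eps, 0 < eps -> exists del, 0 < del /\
    forall h, norm h < del ->
      Rabs (V (vadd x h) - V x - dot g h) <= eps * norm h.

Definition differentiable {d} (V : vec d -> R) : Prop :=
  forall x, exists g, has_gradient V x g.

(* Main.v *)
From Stdlib Require Import Arith Factorial Reals Lra Lia ClassicalEpsilon
  FunctionalExtensionality.
From Coquelicot Require Import Coquelicot.
Require Import Defs.
Open Scope R_scope.

(** Let [x] be a solution and [v = V o x].  At a time [t] put [p] for the gradient
    of [V] at [x t] and [h s = <p, x s>].  Convexity gives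
    [h s - h t <= v s - v t] for all earlier [s], and [h] is a scalar fractional
    integral with density [<p, f (x s)> / Gamma alpha].  Testing [h] with the
    truncated Marchaud weight [(t-s)^(-alpha-1)] and exchanging the integrals, which
    is explicit for this weight, bounds the Marchaud derivative of [v] at [t] by
    [<p, f (x t)>] up to a positive factor.

    Stability: at a maximum [t] of [v] over its past with [v t > v 0] the Marchaud
    derivative would be positive.  Hence [v <= v 0] as long as [x] stays in the ball,
    and (V.ii) confines [x].  Decay: if [v >= m > 0] at a late time, maximise
    [v s + k s] instead; at the maximum the Marchaud derivative is at least
    [- C k^alpha] uniformly in time, against [<p, f (x t)> <= - delta m], which is
    absurd for small [k].  Existence is Picard iteration for [f] precomposed with a
    clamping map, in a norm weighted by [exp (- lam t)]. *)

(** * Real powers *)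

(** The obstacle is regularity: [V] is merely differentiable and [x] merely continuous, so [V o x]
    need not have a Caputo derivative and no chain rule is at hand. Freezing the gradient at the
    single time [t] replaces [V o x] by a linear functional of [x], which the equation itself
    presents as a fractional integral. Its density is only continuous, so the Marchaud integral over
    the whole of [[0,t]] is not known to converge; the weight is therefore cut at some [a < t], and
    only a one-sided estimate that survives as [a] tends to [t] is used. The weight suits the kernel
    because the integral of [(t-s)^(-al-1) (s-u)^(al-1)] over [[u,a]] is elementary; no Beta
    function enters, and positivity is all that is required of Gamma. Memory forbids restarting the
    equation at a later time. Hence decay is read off from the entire history by a tilted maximum,
    and existence is obtained on the whole half-line at once instead of by continuation. *)

Lemma rpow_pos x p : 0 < x -> rpow x p = Rpower x p.
Proof. intros H; unfold rpow; destruct (Rle_dec x 0); [lra | reflexivity]. Qed.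

Lemma rpow_nonpos x p : x <= 0 -> rpow x p = 0.
Proof. intros H; unfold rpow; destruct (Rle_dec x 0); [reflexivity | lra]. Qed.

Lemma Rpower_gt0 x p : 0 < Rpower x p.
Proof. apply exp_pos. Qed.

Lemma rpow_gt0 x p : 0 < x -> 0 < rpow x p.
Proof. intros H; rewrite rpow_pos by exact H; apply Rpower_gt0. Qed.

Lemma rpow_ge0 x p : 0 <= rpow x p.
Proof.
  destruct (Rle_lt_dec x 0) as [H|H];
    [rewrite rpow_nonpos by exact H; lra | left; apply rpow_gt0; exact H].
Qed.

Lemma rpow_1_l p : rpow 1 p = 1.
Proof.
  rewrite rpow_pos by lra; unfold Rpower; rewrite ln_1, Rmult_0_r; apply exp_0.
Qed.

Lemma rpow_le x y p : 0 < p -> x <= y -> rpow x p <= rpow y p.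
Proof.
  intros Hp H. destruct (Rle_lt_dec x 0) as [Hx|Hx].
  - rewrite (rpow_nonpos x) by exact Hx; apply rpow_ge0.
  - rewrite !rpow_pos by lra. apply Rle_Rpower_l; lra.
Qed.

Lemma rpow_lt x y p : 0 < p -> 0 <= x < y -> rpow x p < rpow y p.
Proof.
  intros Hp [H0 H]. destruct (Rle_lt_dec x 0) as [Hx|Hx].
  - rewrite (rpow_nonpos x) by exact Hx; apply rpow_gt0; lra.
  - rewrite !rpow_pos by lra. apply Rlt_Rpower_l; lra.
Qed.

Lemma rpow_rpow x p q : rpow (rpow x p) q = rpow x (p * q).
Proof.
  destruct (Rle_lt_dec x 0) as [Hx|Hx].
  - rewrite (rpow_nonpos x p), (rpow_nonpos x (p * q)) by exact Hx.
    apply rpow_nonpos; lra.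
  - rewrite rpow_pos by (apply rpow_gt0; exact Hx).
    rewrite !rpow_pos by exact Hx. apply Rpower_mult.
Qed.

Lemma rpow_1_r x : 0 <= x -> rpow x 1 = x.
Proof.
  intros [H|H].
  - rewrite rpow_pos by exact H; apply Rpower_1; exact H.
  - subst; apply rpow_nonpos; lra.
Qed.

Lemma rpow_inv x p : p <> 0 -> 0 <= x -> rpow (rpow x p) (/ p) = x.
Proof. intros Hp Hx; rewrite rpow_rpow, Rinv_r by exact Hp; apply rpow_1_r, Hx. Qed.

Lemma rpow_inv' x p : p <> 0 -> 0 <= x -> rpow (rpow x (/ p)) p = x.
Proof. intros Hp Hx; rewrite rpow_rpow, Rinv_l by exact Hp; apply rpow_1_r, Hx. Qed.

Lemma continuity_rpow p : 0 < p -> continuity (fun x => rpow x p).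
Proof.
  intros Hp x.
  destruct (Rlt_or_le 0 x) as [Hx|Hx].
  - assert (Hc : continuity_pt (fun y => Rpower y p) x).
    { apply derivable_continuous_pt. exists (p * Rpower x (p - 1)).
      apply derivable_pt_lim_power; exact Hx. }
    apply continuity_pt_ext_loc with (2 := Hc).
    exists (mkposreal x Hx). intros y Hy.
    unfold ball in Hy; simpl in Hy; unfold AbsRing_ball, abs, minus, plus, opp in Hy; simpl in Hy.
    apply Rabs_lt_between in Hy. symmetry; apply rpow_pos; lra.
  - intros eps Heps.
    exists (rpow eps (/ p)). split; [apply rpow_gt0; exact Heps|].
    intros y [_ Hy]; simpl in *; unfold Rdist in *.
    rewrite (rpow_nonpos x) by exact Hx.
    rewrite Rminus_0_r, Rabs_pos_eq by apply rpow_ge0.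
    destruct (Rle_lt_dec y 0) as [Hy0|Hy0]; [rewrite rpow_nonpos; lra|].
    rewrite <- (rpow_inv' eps p) by lra.
    apply rpow_lt; [exact Hp|]. apply Rabs_lt_between in Hy. lra.
Qed.

Lemma is_derive_Rpower x p :
  0 < x -> is_derive (fun y => Rpower y p) x (p * Rpower x (p - 1)).
Proof. intros H; apply is_derive_Reals, derivable_pt_lim_power, H. Qed.

Lemma Rpower_le_neg x y p : p <= 0 -> 0 < x <= y -> Rpower y p <= Rpower x p.
Proof.
  intros Hp H. replace p with (- - p) by ring. rewrite !(Rpower_Ropp _ (- p)).
  apply Rinv_le_contravar; [apply Rpower_gt0|]. apply Rle_Rpower_l; lra.
Qed.

(** * Positivity of Gauss' limit *)

Lemma Rpower_le_linear x p : 0 < p < 1 -> -1 < x -> Rpower (1 + x) p <= 1 + p * x.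
Proof.
  intros Hp Hx.
  (* Jensen's inequality for [ln], from the tangent at [1 + p x] *)
  assert (H : forall y z, 0 < y -> 0 < z -> ln z <= ln y + (z - y) / y).
  { intros y z Hy Hz.
    replace z with (y * (z / y)) at 1 by (field; lra).
    assert (0 < z / y) by (apply Rdiv_lt_0_compat; lra).
    rewrite ln_mult by lra.
    pose proof (exp_ineq1_le (ln (z / y))) as E.
    rewrite exp_ln in E by lra.
    replace ((z - y) / y) with (z / y - 1) by (field; lra). lra. }
  assert (Hpos : 0 < 1 + p * x) by nra.
  unfold Rpower. rewrite <- (exp_ln (1 + p * x)) by exact Hpos.
  assert (E1 := H (1 + p * x) (1 + x) Hpos ltac:(lra)).
  assert (E2 := H (1 + p * x) 1 Hpos ltac:(lra)).
  rewrite ln_1 in E2.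
  assert (E : p * ln (1 + x) <= ln (1 + p * x)).
  { apply Rle_trans with (p * (ln (1 + p * x) + (1 + x - (1 + p * x)) / (1 + p * x))
       + (1 - p) * (ln (1 + p * x) + (1 - (1 + p * x)) / (1 + p * x))).
    - assert (p * ln (1 + x) <= p * (ln (1 + p * x) + (1 + x - (1 + p * x)) / (1 + p * x)))
        by (apply Rmult_le_compat_l; lra).
      assert (0 <= (1 - p) * (ln (1 + p * x) + (1 - (1 + p * x)) / (1 + p * x)))
        by (apply Rmult_le_pos; lra).
      lra.
    - right. field. lra. }
  destruct E as [E|E]; [left; apply exp_increasing; exact E | rewrite E; right; reflexivity].
Qed.

Lemma prod_f_R0_pos (u : nat -> R) n : (forall k, 0 < u k) -> 0 < prod_f_R0 u n.
Proof.
  intros H; induction n; simpl; [apply H|]. apply Rmult_lt_0_compat; auto.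
Qed.

Lemma Gamma_seq_pos a n : 0 < a -> 0 < Gamma_seq a n.
Proof.
  intros Ha. unfold Gamma_seq. apply Rdiv_lt_0_compat.
  - apply Rmult_lt_0_compat; [apply lt_0_INR, lt_O_fact | apply Rpower_gt0].
  - apply prod_f_R0_pos. intros k. pose proof (pos_INR k). lra.
Qed.

Lemma Gamma_seq_S a n : 0 < a ->
  Gamma_seq a (S (S n)) =
  Gamma_seq a (S n) * (Rpower (1 + / INR (S n)) a / (1 + a / INR (S (S n)))).
Proof.
  intros Ha. unfold Gamma_seq.
  assert (H1 : 0 < INR (S n)) by (apply lt_0_INR; lia).
  assert (H2 : 0 < INR (S (S n))) by (apply lt_0_INR; lia).
  assert (E : Rpower (INR (S (S n))) a = Rpower (INR (S n)) a * Rpower (1 + / INR (S n)) a).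
  { assert (0 < / INR (S n)) by (apply Rinv_0_lt_compat; lra).
    rewrite Rpower_mult_distr by lra. f_equal.
    rewrite (S_INR (S n)). field. lra. }
  rewrite E.
  replace (prod_f_R0 (fun k => a + INR k) (S (S n)))
    with (prod_f_R0 (fun k => a + INR k) (S n) * (a + INR (S (S n)))) by reflexivity.
  replace (INR (fact (S (S n)))) with (INR (S (S n)) * INR (fact (S n)))
    by (rewrite <- mult_INR; reflexivity).
  assert (0 < prod_f_R0 (fun k => a + INR k) (S n)).
  { apply prod_f_R0_pos. intros k. pose proof (pos_INR k). lra. }
  field. repeat split; lra.
Qed.

(** Since [1 + 1/m] is the inverse of [1 - 1/(m+1)], Bernoulli's inequality at [- / (m + 1)] bounds
    the numerator of the ratio in [Gamma_seq_S] from below by [1 / (1 - a/(m+1))], which exceeds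
    [1 + a/(m+1)]. *)
Lemma Gamma_seq_growing a n : 0 < a < 1 -> Gamma_seq a (S n) <= Gamma_seq a (S (S n)).
Proof.
  intros Ha. rewrite Gamma_seq_S by lra.
  assert (H1 : 0 < INR (S n)) by (apply lt_0_INR; lia).
  assert (H2 : INR (S (S n)) = INR (S n) + 1) by (rewrite (S_INR (S n)); reflexivity).
  pose proof (Gamma_seq_pos a (S n) ltac:(lra)) as HG.
  rewrite <- (Rmult_1_r (Gamma_seq a (S n))) at 1.
  apply Rmult_le_compat_l; [lra|].
  set (m := INR (S n)) in *. rewrite H2.
  assert (Hi : 0 < / (m + 1) < 1).
  { split; [apply Rinv_0_lt_compat; lra|].
    apply Rmult_lt_reg_l with (m + 1); [lra|]. rewrite Rinv_r by lra. lra. }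
  assert (Hd : 0 < 1 + a / (m + 1)) by (unfold Rdiv; nra).
  apply Rmult_le_reg_r with (1 + a / (m + 1)); [exact Hd|].
  unfold Rdiv at 2. rewrite Rmult_assoc, Rinv_l, Rmult_1_r, Rmult_1_l by lra.
  pose proof (Rpower_le_linear (- / (m + 1)) a Ha ltac:(lra)) as E.
  assert (Epos := Rpower_gt0 (1 + / m) a).
  assert (Em : Rpower (1 + / m) a * Rpower (1 + - / (m + 1)) a = 1).
  { assert (0 < / m) by (apply Rinv_0_lt_compat; lra).
    rewrite Rpower_mult_distr by lra.
    replace ((1 + / m) * (1 + - / (m + 1))) with 1 by (field; lra).
    unfold Rpower; rewrite ln_1, Rmult_0_r; apply exp_0. }
  assert (1 <= Rpower (1 + / m) a * (1 + a * - / (m + 1))).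
  { rewrite <- Em at 1. apply Rmult_le_compat_l; lra. }
  unfold Rdiv. set (i := / (m + 1)) in *.
  assert (0 < a * i < 1) by nra.
  apply Rmult_le_reg_r with (1 - a * i); nra.
Qed.

(** The extra factor turns the increasing sequence into a decreasing one: the ratio of successive
    terms becomes [(1+i)^a / (1 + a i)], at most one by Bernoulli's inequality. *)
Lemma Gamma_seq_bounded a n :
  0 < a < 1 ->
  Gamma_seq a (S n) * Rpower (1 + / INR (S n)) a <= Gamma_seq a 1 * Rpower 2 a.
Proof.
  intros Ha. induction n as [|n IH].
  - simpl INR. right. do 2 f_equal. field.
  - apply Rle_trans with (2 := IH). rewrite Gamma_seq_S by lra.
    assert (H2 : 0 < INR (S (S n))) by (apply lt_0_INR; lia).
    assert (Hi : 0 < / INR (S (S n))) by (apply Rinv_0_lt_compat; lra).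
    pose proof (Gamma_seq_pos a (S n) ltac:(lra)) as HG.
    pose proof (Rpower_gt0 (1 + / INR (S n)) a) as HP.
    pose proof (Rpower_le_linear (/ INR (S (S n))) a Ha ltac:(lra)) as E.
    unfold Rdiv. set (i := / INR (S (S n))) in *.
    assert (Hd : 0 < 1 + a * i) by nra.
    replace (Gamma_seq a (S n) * (Rpower (1 + / INR (S n)) a * / (1 + a * i)) * Rpower (1 + i) a)
      with (Gamma_seq a (S n) * Rpower (1 + / INR (S n)) a * (Rpower (1 + i) a / (1 + a * i)))
      by (field; lra).
    rewrite <- Rmult_1_r. apply Rmult_le_compat_l; [nra|].
    apply Rmult_le_reg_r with (1 + a * i); [exact Hd|].
    unfold Rdiv. rewrite Rmult_assoc, Rinv_l by lra. lra.
Qed.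

(** [Gamma] is an [epsilon] choice and says nothing until Gauss' sequence is known to converge. The
    monotone limit then dominates the positive term of index one; the shift to [S n] skips the index
    where [INR n] vanishes. *)
Lemma Gamma_pos a : 0 < a < 1 -> 0 < Gamma a.
Proof.
  intros Ha.
  assert (Hex : ex_finite_lim_seq (fun n => Gamma_seq a (S n))).
  { apply ex_finite_lim_seq_incr with (M := Gamma_seq a 1 * Rpower 2 a).
    - intros n. apply Gamma_seq_growing; exact Ha.
    - intros n. apply Rle_trans with (2 := Gamma_seq_bounded a n Ha).
      pose proof (Gamma_seq_pos a (S n) ltac:(lra)).
      assert (0 < / INR (S n)) by (apply Rinv_0_lt_compat, lt_0_INR; lia).
      assert (1 <= Rpower (1 + / INR (S n)) a).
      { rewrite <- (Rpower_O (1 + / INR (S n))) at 1 by lra. apply Rle_Rpower; lra. }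
      nra. }
  destruct Hex as [l Hl].
  assert (Hl1 : Gamma_seq a 1 <= l).
  { apply (is_lim_seq_incr_compare (fun n => Gamma_seq a (S n)) l Hl) with (n := O).
    intros n. apply Gamma_seq_growing; exact Ha. }
  pose proof (Gamma_seq_pos a 1 ltac:(lra)).
  assert (Hcv : exists g, Un_cv (Gamma_seq a) g).
  { exists l. apply is_lim_seq_Reals. apply is_lim_seq_incr_1. exact Hl. }
  pose proof (epsilon_spec (inhabits 0) (fun g => Un_cv (Gamma_seq a) g) Hcv) as Hg.
  fold (Gamma a) in Hg. simpl in Hg.
  assert (Gamma a = l); [|lra].
  apply (UL_sequence _ _ _ Hg). apply is_lim_seq_Reals, is_lim_seq_incr_1, Hl.
Qed.

(** * The Riemann-Liouville integral as a proper integral *)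

Lemma continuity_continuous (g : R -> R) x : continuity g -> continuous g x.
Proof. intros H; apply continuity_pt_filterlim, H. Qed.

Lemma ex_RInt_continuity (g : R -> R) a b : continuity g -> ex_RInt g a b.
Proof.
  intros H. apply (ex_RInt_continuous (V := R_CompleteNormedModule)). intros z _.
  apply continuity_continuous, H.
Qed.

(** Heine's theorem on the rectangle. It serves twice: for the continuity of [frac] in time, and for
    letting the shift [eta] tend to zero in the exchange of integrals. *)
Lemma RInt_param_continuity_pt (F : R -> R -> R) a b x0 e :
  a <= b -> 0 < e ->
  (forall x y, x0 - e <= x <= x0 + e -> a <= y <= b -> continuity_2d_pt F x y) ->
  continuity_pt (fun x => RInt (F x) a b) x0.
Proof.
  intros Hab He HF.
  assert (Hex : forall x, x0 - e <= x <= x0 + e -> ex_RInt (F x) a b).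
  { intros x Hx. apply (ex_RInt_continuous (V := R_CompleteNormedModule)).
    intros y Hy. rewrite Rmin_left, Rmax_right in Hy by exact Hab.
    apply continuity_pt_filterlim. intros eps Heps.
    destruct (HF x y Hx Hy (mkposreal eps Heps)) as [del Hdel].
    exists del. split; [apply cond_pos|]. intros z [_ Hz].
    apply (Hdel x z); [rewrite Rminus_diag, Rabs_R0; apply cond_pos | exact Hz]. }
  intros eps Heps.
  assert (Hepos : 0 < eps / (b - a + 1) / 2).
  { repeat apply Rdiv_lt_0_compat; lra. }
  destruct (uniform_continuity_2d F (x0 - e) (x0 + e) a b HF (mkposreal _ Hepos)) as [del Hdel].
  exists (Rmin e del). split; [apply Rmin_glb_lt; [exact He | apply cond_pos]|].
  intros x [_ Hx]. simpl in Hx. unfold Rdist in Hx. simpl. unfold Rdist.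
  assert (Hxe : x0 - e <= x <= x0 + e).
  { assert (Hx' : Rabs (x - x0) < e) by (apply Rlt_le_trans with (1 := Hx); apply Rmin_l).
    apply Rabs_lt_between in Hx'; lra. }
  assert (H0 : x0 - e <= x0 <= x0 + e) by lra.
  rewrite <- (RInt_minus (V := R_CompleteNormedModule) (F x) (F x0)) by auto.
  apply Rle_lt_trans with ((b - a) * (eps / (b - a + 1) / 2)).
  - apply abs_RInt_le_const; [exact Hab | |].
    + apply (ex_RInt_minus (V := R_NormedModule)); auto.
    + intros y Hy. left. apply (Hdel x0 y x y); auto.
      * apply Rlt_le_trans with (1 := Hx). apply Rmin_r.
      * rewrite Rminus_diag, Rabs_R0; apply cond_pos.
  - replace eps with ((b - a + 1) * (eps / (b - a + 1) / 2) * 2) at 2 by (field; lra).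
    set (q := eps / (b - a + 1) / 2) in *. nra.
Qed.

(** This is [Gamma al] times the Riemann-Liouville integral, after the substitution
    [z = ((t-u)/t)^al]. The integrand is now continuous on [[0,1]], so linearity, monotonicity and
    continuity in [t] reduce to proper integrals; the prefactor makes the value zero at negative
    times. *)
Definition frac (al : R) (g : R -> R) (t : R) : R :=
  rpow t al / al * RInt (fun z => g (t * (1 - rpow z (/ al)))) 0 1.

Lemma continuity_kernel al (g : R -> R) t :
  0 < al -> continuity g -> continuity (fun z => g (t * (1 - rpow z (/ al)))).
Proof.
  intros Hal Hg z.
  apply (continuity_pt_comp (fun z => t * (1 - rpow z (/ al))) g); [|apply Hg].
  apply continuity_pt_mult; [apply continuity_pt_const; intros ? ?; reflexivity|].
  apply continuity_pt_minus; [apply continuity_pt_const; intros ? ?; reflexivity|].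
  apply continuity_rpow, Rinv_0_lt_compat, Hal.
Qed.

Lemma kernel_range al t z :
  0 < al -> 0 <= t -> 0 <= z <= 1 -> 0 <= t * (1 - rpow z (/ al)) <= t.
Proof.
  intros Hal Ht Hz.
  assert (0 <= rpow z (/ al) <= 1).
  { split; [apply rpow_ge0|]. rewrite <- (rpow_1_l (/ al)).
    apply rpow_le; [apply Rinv_0_lt_compat, Hal | apply Hz]. }
  nra.
Qed.

Lemma continuity_frac al g : 0 < al -> continuity g -> continuity (frac al g).
Proof.
  intros Hal Hg t. unfold frac.
  apply (continuity_pt_mult (fun t => rpow t al / al)).
  - apply (continuity_pt_mult (fun t => rpow t al) (fun _ => / al)).
    + apply continuity_rpow, Hal.
    + apply continuity_pt_const; intros ? ?; reflexivity.
  - apply (RInt_param_continuity_pt (fun t z => g (t * (1 - rpow z (/ al)))) 0 1 t 1); try lra.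
    intros x y _ _.
    apply (continuity_1d_2d_pt_comp g (fun x y => x * (1 - rpow y (/ al)))); [apply Hg|].
    apply (continuity_2d_pt_mult (fun x _ => x)); [apply continuity_2d_pt_id1|].
    apply (continuity_2d_pt_minus (fun _ _ => 1)); [apply continuity_2d_pt_const|].
    apply (continuity_1d_2d_pt_comp (fun y => rpow y (/ al)) (fun _ y => y)).
    + apply continuity_rpow, Rinv_0_lt_compat, Hal.
    + apply continuity_2d_pt_id2.
Qed.

Lemma frac_nonpos al g t : t <= 0 -> frac al g t = 0.
Proof. intros H; unfold frac; rewrite rpow_nonpos by exact H. unfold Rdiv. ring. Qed.

Lemma frac_ext al g1 g2 t : 0 < al ->
  (forall s, 0 <= s <= t -> g1 s = g2 s) -> frac al g1 t = frac al g2 t.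
Proof.
  intros Hal H. destruct (Rle_lt_dec t 0) as [Ht|Ht].
  - rewrite !frac_nonpos by exact Ht; reflexivity.
  - unfold frac. f_equal. apply RInt_ext. intros z Hz.
    rewrite Rmin_left, Rmax_right in Hz by lra.
    apply H, kernel_range; lra.
Qed.

Lemma frac_scal al c g t : 0 < al -> continuity g ->
  frac al (fun s => c * g s) t = c * frac al g t.
Proof.
  intros Hal Hg. unfold frac.
  rewrite (RInt_scal (V := R_CompleteNormedModule) (fun z => g (t * (1 - rpow z (/ al)))))
    by (apply ex_RInt_continuity, continuity_kernel; assumption).
  unfold scal; simpl; unfold mult; simpl; ring.
Qed.

Lemma frac_plus al g1 g2 t : 0 < al -> continuity g1 -> continuity g2 ->
  frac al (fun s => g1 s + g2 s) t = frac al g1 t + frac al g2 t.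
Proof.
  intros Hal Hg1 Hg2. unfold frac.
  rewrite (RInt_plus (V := R_CompleteNormedModule) (fun z => g1 (t * (1 - rpow z (/ al)))))
    by (apply ex_RInt_continuity, continuity_kernel; assumption).
  unfold plus; simpl; ring.
Qed.

Lemma frac_const al c t : frac al (fun _ => c) t = rpow t al / al * c.
Proof.
  unfold frac. rewrite RInt_const. unfold scal; simpl; unfold mult; simpl. ring.
Qed.

Lemma frac_le al g1 g2 t : 0 < al -> continuity g1 -> continuity g2 ->
  (forall s, 0 <= s <= t -> g1 s <= g2 s) -> frac al g1 t <= frac al g2 t.
Proof.
  intros Hal Hg1 Hg2 H. destruct (Rle_lt_dec t 0) as [Ht|Ht].
  { rewrite !frac_nonpos by exact Ht; lra. }
  unfold frac. apply Rmult_le_compat_l.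
  - apply Rdiv_le_0_compat; [apply rpow_ge0 | exact Hal].
  - apply RInt_le; [lra | | |].
    + apply ex_RInt_continuity, continuity_kernel; assumption.
    + apply ex_RInt_continuity, continuity_kernel; assumption.
    + intros z Hz. apply H, kernel_range; lra.
Qed.

Lemma frac_abs_le al g G t : 0 < al -> continuity g -> continuity G ->
  (forall s, 0 <= s <= t -> Rabs (g s) <= G s) -> Rabs (frac al g t) <= frac al G t.
Proof.
  intros Hal Hg HG H. apply Rabs_le. split.
  - replace (- frac al G t) with (frac al (fun s => -1 * G s) t)
      by (rewrite frac_scal by assumption; ring).
    apply frac_le; try assumption.
    + apply (continuity_scal G (-1)); exact HG.
    + intros s Hs. apply H in Hs. apply Rabs_le_between in Hs. lra.
  - apply frac_le; try assumption.
    intros s Hs. apply H in Hs. apply Rabs_le_between in Hs. lra.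
Qed.

(* Substituting [z = ((t-u)/t)^al] removes the singularity at [u = t]. *)
Lemma is_RInt_frac_truncated al g t s : 0 < al -> continuity g -> 0 <= s < t ->
  is_RInt (fun u => Rpower (t - u) (al - 1) * g u) 0 s
    (rpow t al / al *
     RInt (fun z => g (t * (1 - rpow z (/ al)))) (rpow ((t - s) / t) al) 1).
Proof.
  intros Hal Hg Hs.
  set (f := fun z => g (t * (1 - rpow z (/ al)))).
  assert (Hf : continuity f) by (apply continuity_kernel; assumption).
  assert (Hpos : forall u, Rmin 0 s <= u <= Rmax 0 s -> 0 < (t - u) / t).
  { intros u Hu. rewrite Rmin_left, Rmax_right in Hu by lra.
    apply Rdiv_lt_0_compat; lra. }
  assert (Hder : forall u p, Rmin 0 s <= u <= Rmax 0 s ->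
    is_derive (fun u => Rpower ((t - u) / t) p) u (- / t * (p * Rpower ((t - u) / t) (p - 1)))).
  { intros u p Hu.
    apply (is_derive_comp (fun y => Rpower y p) (fun u => (t - u) / t)).
    - apply is_derive_Rpower, Hpos, Hu.
    - auto_derive; [exact I|]. field. lra. }
  pose proof (is_RInt_comp (V := R_CompleteNormedModule) f
    (fun u => Rpower ((t - u) / t) al)
    (fun u => - / t * (al * Rpower ((t - u) / t) (al - 1))) 0 s) as Hc.
  assert (Hc' := Hc (fun u _ => continuity_continuous f _ Hf)). clear Hc.
  assert (Hd : forall u, Rmin 0 s <= u <= Rmax 0 s ->
     is_derive (fun u => Rpower ((t - u) / t) al) u
       (- / t * (al * Rpower ((t - u) / t) (al - 1))) /\
     continuous (fun u => - / t * (al * Rpower ((t - u) / t) (al - 1))) u).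
  { intros u Hu. split; [apply Hder, Hu|].
    apply (ex_derive_continuous (V := R_NormedModule)).
    apply ex_derive_scal, ex_derive_scal. eexists. apply Hder, Hu. }
  specialize (Hc' Hd). clear Hd.
  cbv beta in Hc'.
  replace ((t - 0) / t) with 1 in Hc' by (field; lra).
  rewrite <- (rpow_pos 1), rpow_1_l in Hc' by lra.
  rewrite <- (rpow_pos ((t - s) / t)) in Hc' by (apply Rdiv_lt_0_compat; lra).
  rewrite <- (opp_RInt_swap (V := R_CompleteNormedModule)) in Hc'
    by (apply ex_RInt_continuity, Hf).
  apply (is_RInt_scal (V := R_NormedModule) _ 0 s (- (Rpower t al / al))) in Hc'.
  rewrite <- (rpow_pos t) in Hc' by lra.
  replace (rpow t al / al * RInt f (rpow ((t - s) / t) al) 1)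
    with (scal (V := R_NormedModule) (- (rpow t al / al))
            (opp (RInt f (rpow ((t - s) / t) al) 1)))
    by (unfold scal, opp; simpl; unfold mult; simpl; ring).
  eapply is_RInt_ext; [|exact Hc'].
  intros u Hu. assert (Hu' : Rmin 0 s <= u <= Rmax 0 s) by lra.
  rewrite Rmin_left, Rmax_right in Hu by lra.
  unfold scal; simpl; unfold mult; simpl. unfold f.
  rewrite <- (rpow_pos ((t - u) / t) al), rpow_inv by (try apply Rlt_le; try apply Hpos; lra).
  replace (t * (1 - (t - u) / t)) with u by (field; lra).
  rewrite (rpow_pos t) by lra.
  replace (Rpower (t - u) (al - 1)) with (Rpower t (al - 1) * Rpower ((t - u) / t) (al - 1)).
  2: { rewrite Rpower_mult_distr by (try apply Hpos; lra). f_equal. field. lra. }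
  replace (Rpower t al) with (Rpower t (al - 1) * t).
  2: { rewrite <- (Rpower_1 t) at 2 by lra. rewrite <- Rpower_plus. f_equal. ring. }
  field. lra.
Qed.

(** The kernel has mass [(t-s)^al / al] on [[s,t]], the stretch that the substitution sends to
    [[0,z0]]. Every later estimate near the singularity goes through this one. *)
Lemma frac_tail_bounds al g t s lo hi :
  0 < al -> continuity g -> 0 <= s < t ->
  (forall u, s <= u <= t -> lo <= g u <= hi) ->
  rpow (t - s) al / al * lo
  <= frac al g t - RInt (fun u => Rpower (t - u) (al - 1) * g u) 0 s
  <= rpow (t - s) al / al * hi.
Proof.
  intros Hal Hg Hs Hb.
  rewrite (is_RInt_unique _ _ _ _ (is_RInt_frac_truncated al g t s Hal Hg Hs)).
  set (f := fun z => g (t * (1 - rpow z (/ al)))).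
  assert (Hf : continuity f) by (apply continuity_kernel; assumption).
  unfold frac. fold f.
  set (z0 := rpow ((t - s) / t) al).
  rewrite <- (RInt_Chasles (V := R_CompleteNormedModule) f 0 z0 1)
    by (apply ex_RInt_continuity, Hf).
  unfold plus; simpl.
  replace (rpow t al / al * (RInt f 0 z0 + RInt f z0 1) - rpow t al / al * RInt f z0 1)
    with (rpow t al / al * RInt f 0 z0) by ring.
  assert (Hpos : 0 < (t - s) / t) by (apply Rdiv_lt_0_compat; lra).
  assert (Hz0 : 0 <= z0) by apply rpow_ge0.
  assert (Hz1 : z0 <= 1).
  { unfold z0. rewrite <- (rpow_1_l al). apply rpow_le; [exact Hal|].
    apply Rmult_le_reg_r with t; [lra|]. unfold Rdiv. rewrite Rmult_assoc, Rinv_l; lra. }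
  assert (Hfb : forall z, 0 <= z <= z0 -> lo <= f z <= hi).
  { intros z Hz. apply Hb.
    assert (rpow z (/ al) <= (t - s) / t).
    { rewrite <- (rpow_inv ((t - s) / t) al) by lra.
      apply rpow_le; [apply Rinv_0_lt_compat, Hal | apply Hz]. }
    pose proof (kernel_range al t z Hal ltac:(lra) ltac:(lra)).
    split; [|lra].
    replace s with (t * (1 - (t - s) / t)) by (field; lra).
    apply Rmult_le_compat_l; lra. }
  assert (Hts : rpow (t - s) al = rpow t al * z0).
  { unfold z0. rewrite !rpow_pos by (try assumption; lra).
    rewrite Rpower_mult_distr by lra. f_equal. field. lra. }
  rewrite Hts.
  assert (Hc : 0 <= rpow t al / al) by (apply Rdiv_le_0_compat; [apply rpow_ge0|lra]).
  assert (Hlo : lo * z0 <= RInt f 0 z0).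
  { replace (lo * z0) with (RInt (fun _ => lo) 0 z0)
      by (rewrite RInt_const; unfold scal; simpl; unfold mult; simpl; ring).
    apply RInt_le; [exact Hz0 | apply ex_RInt_const | apply ex_RInt_continuity, Hf|].
    intros z Hz. apply Hfb. lra. }
  assert (Hhi : RInt f 0 z0 <= hi * z0).
  { replace (hi * z0) with (RInt (fun _ => hi) 0 z0)
      by (rewrite RInt_const; unfold scal; simpl; unfold mult; simpl; ring).
    apply RInt_le; [exact Hz0 | apply ex_RInt_continuity, Hf | apply ex_RInt_const |].
    intros z Hz. apply Hfb. lra. }
  unfold Rdiv in *. split.
  - replace (rpow t al * z0 * / al * lo) with (rpow t al * / al * (lo * z0)) by ring.
    apply Rmult_le_compat_l; assumption.
  - replace (rpow t al * z0 * / al * hi) with (rpow t al * / al * (hi * z0)) by ring.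
    apply Rmult_le_compat_l; assumption.
Qed.

Lemma continuity_bounded (g : R -> R) a b : continuity g ->
  exists M, 0 < M /\ forall u, a <= u <= b -> - M <= g u <= M.
Proof.
  intros Hg. destruct (Rle_lt_dec a b) as [Hab|Hab].
  2: { exists 1. split; [lra|]. intros u Hu. lra. }
  destruct (continuity_ab_maj (fun u => Rabs (g u)) a b Hab) as [m [Hm _]].
  - intros u _. apply (continuity_pt_comp g Rabs); [apply Hg | apply Rcontinuity_abs].
  - exists (Rabs (g m) + 1). pose proof (Rabs_pos (g m)). split; [lra|].
    intros u Hu. specialize (Hm u Hu). apply Rabs_le_between in Hm. lra.
Qed.

Lemma rpow_small p eps : 0 < p -> 0 < eps ->
  exists del, 0 < del /\ forall x, x < del -> rpow x p < eps.
Proof.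
  intros Hp He. exists (rpow eps (/ p)). split; [apply rpow_gt0, He|].
  intros x Hx. destruct (Rle_lt_dec x 0) as [H|H].
  - rewrite rpow_nonpos; lra.
  - rewrite <- (rpow_inv' eps p) by lra. apply rpow_lt; lra.
Qed.

(** Bridge from the improper integral of the statement: the missing tail is at most
    [M (t-s)^al / al], which the choice of [del] makes smaller than [eps]. *)
Lemma sing_int_frac al g t : 0 < al -> continuity g -> 0 < t ->
  sing_int al g t (frac al g t).
Proof.
  intros Hal Hg Ht eps Heps.
  destruct (continuity_bounded g 0 t Hg) as [M [HM Hb]].
  destruct (rpow_small al (eps * al / M) Hal) as [del [Hdel Hsm]].
  { apply Rdiv_lt_0_compat; [apply Rmult_lt_0_compat|]; lra. }
  exists del. split; [exact Hdel|]. intros s Hs Hs'.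
  pose proof (is_RInt_frac_truncated al g t s Hal Hg Hs) as HI.
  exists (ex_RInt_Reals_0 _ _ _ (ex_intro _ _ HI)).
  rewrite <- RInt_Reals.
  pose proof (frac_tail_bounds al g t s (- M) M Hal Hg Hs) as Hh.
  assert (Hh' := Hh (fun u Hu => Hb u ltac:(lra))). clear Hh.
  specialize (Hsm (t - s) ltac:(lra)).
  assert (rpow (t - s) al / al * M < eps).
  { apply Rmult_lt_reg_r with (al / M); [apply Rdiv_lt_0_compat; lra|].
    replace (rpow (t - s) al / al * M * (al / M)) with (rpow (t - s) al) by (field; lra).
    replace (eps * (al / M)) with (eps * al / M) by (field; lra). exact Hsm. }
  apply Rabs_def1; lra.
Qed.

Lemma sing_int_ext al g1 g2 t w : (forall s, 0 <= s < t -> g1 s = g2 s) ->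
  sing_int al g1 t w -> sing_int al g2 t w.
Proof.
  intros He H eps Heps. destruct (H eps Heps) as [del [Hdel Hd]].
  exists del. split; [exact Hdel|]. intros s Hs Hs'.
  destruct (Hd s Hs Hs') as [pr Hpr].
  assert (Hext : forall u, Rmin 0 s < u < Rmax 0 s ->
     Rpower (t - u) (al - 1) * g1 u = Rpower (t - u) (al - 1) * g2 u).
  { intros u Hu. rewrite Rmin_left, Rmax_right in Hu by lra. rewrite He; [reflexivity|lra]. }
  pose proof (ex_RInt_ext _ _ _ _ Hext (ex_RInt_Reals_1 _ _ _ pr)) as HI.
  exists (ex_RInt_Reals_0 _ _ _ HI).
  rewrite <- RInt_Reals in *. rewrite <- (RInt_ext _ _ _ _ Hext). exact Hpr.
Qed.

Lemma sing_int_unique al g t w1 w2 : 0 < t ->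
  sing_int al g t w1 -> sing_int al g t w2 -> w1 = w2.
Proof.
  intros Ht H1 H2. destruct (Req_dec w1 w2) as [E|E]; [exact E|exfalso].
  assert (Hp : 0 < Rabs (w1 - w2) / 2).
  { apply Rdiv_lt_0_compat; [|lra]. apply Rabs_pos_lt. lra. }
  destruct (H1 _ Hp) as [d1 [Hd1 K1]]. destruct (H2 _ Hp) as [d2 [Hd2 K2]].
  set (m := Rmin (Rmin d1 d2) t).
  assert (Hm : 0 < m) by (unfold m; repeat apply Rmin_glb_lt; assumption).
  assert (Hm1 : m <= d1) by (unfold m; apply Rle_trans with (Rmin d1 d2); apply Rmin_l).
  assert (Hm2 : m <= d2)
    by (unfold m; apply Rle_trans with (Rmin d1 d2); [apply Rmin_l | apply Rmin_r]).
  assert (Hmt : m <= t) by (unfold m; apply Rmin_r).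
  destruct (K1 (t - m / 2) ltac:(lra) ltac:(lra)) as [p1 Hp1].
  destruct (K2 (t - m / 2) ltac:(lra) ltac:(lra)) as [p2 Hp2].
  rewrite <- RInt_Reals in Hp1, Hp2.
  assert (Rabs (w1 - w2) < Rabs (w1 - w2)); [|lra].
  match type of Hp1 with Rabs (?J - _) < _ => set (I := J) in * end.
  replace (w1 - w2) with ((I - w2) + - (I - w1)) at 1 by ring.
  eapply Rle_lt_trans; [apply Rabs_triang|]. rewrite Rabs_Ropp. lra.
Qed.

(** * The truncated Marchaud derivative of a fractional integral *)

(* [primitive_kernel al T eta u x] is the integral over [s] from [u] to [x] of
   [(T-s)^(-al-1) (s-u+eta)^(al-1)]: the shift [eta] keeps both factors regular
   while preserving the closed form. *)
Definition primitive_kernel (al T eta u x : R) : R :=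
  (Rpower (x - u + eta) al * Rpower (T - x) (- al)
   - Rpower eta al * Rpower (T - u) (- al)) / (al * (T - u + eta)).

Lemma is_derive_primitive_kernel al T eta u x :
  0 < al -> x < T -> u < x + eta ->
  is_derive (primitive_kernel al T eta u) x
    (Rpower (T - x) (- al - 1) * Rpower (x - u + eta) (al - 1)).
Proof.
  intros Hal Hx Hu.
  assert (H1 : is_derive (fun y => Rpower (y - u + eta) al) x
                 (1 * (al * Rpower (x - u + eta) (al - 1)))).
  { apply (is_derive_comp (fun y => Rpower y al) (fun y => y - u + eta)).
    - apply is_derive_Rpower; lra.
    - auto_derive; [exact I | ring]. }
  assert (H2 : is_derive (fun y => Rpower (T - y) (- al)) x
                 (- (1) * (- al * Rpower (T - x) (- al - 1)))).
  { apply (is_derive_comp (fun y => Rpower y (- al)) (fun y => T - y)).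
    - apply is_derive_Rpower; lra.
    - auto_derive; [exact I | ring]. }
  pose proof (is_derive_mult _ _ _ _ _ H1 H2 Rmult_comm) as H3.
  pose proof (is_derive_const (K := R_AbsRing) (V := R_NormedModule)
                (Rpower eta al * Rpower (T - u) (- al)) x) as H4.
  pose proof (is_derive_minus _ _ _ _ _ H3 H4) as H5.
  pose proof (is_derive_scal _ _ (/ (al * (T - u + eta))) _ H5) as H6.
  eapply is_derive_ext; [|evar_last; [exact H6|]].
  - intros y. unfold primitive_kernel, minus, plus, opp, mult; simpl. unfold Rdiv.
    rewrite Rmult_comm. reflexivity.
  - unfold minus, plus, opp, mult, zero; simpl.
    replace (Rpower (x - u + eta) al)
      with (Rpower (x - u + eta) (al - 1) * (x - u + eta)).
    2: { rewrite <- (Rpower_1 (x - u + eta)) at 2 by lra.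
         rewrite <- Rpower_plus. f_equal. ring. }
    replace (Rpower (T - x) (- al))
      with (Rpower (T - x) (- al - 1) * (T - x)).
    2: { rewrite <- (Rpower_1 (T - x)) at 2 by lra.
         rewrite <- Rpower_plus. f_equal. ring. }
    field. split; lra.
Qed.

Lemma ex_derive_continuity_pt (f : R -> R) x : ex_derive f x -> continuity_pt f x.
Proof.
  intros H. apply continuity_pt_filterlim.
  exact (ex_derive_continuous (V := R_NormedModule) f x H).
Qed.

Lemma continuity_pt_Rpower x p : 0 < x -> continuity_pt (fun y => Rpower y p) x.
Proof.
  intros H. apply ex_derive_continuity_pt.
  exists (p * Rpower x (p - 1)). exact (is_derive_Rpower x p H).
Qed.

Lemma continuity_2d_pt_snd (g : R -> R) x y :
  continuity_pt g y -> continuity_2d_pt (fun _ v => g v) x y.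
Proof.
  intros H. apply (continuity_1d_2d_pt_comp g (fun _ v => v)); [exact H|].
  apply continuity_2d_pt_id2.
Qed.

Lemma continuity_2d_pt_fst (g : R -> R) x y :
  continuity_pt g x -> continuity_2d_pt (fun u _ => g u) x y.
Proof.
  intros H. apply (continuity_1d_2d_pt_comp g (fun u _ => u)); [exact H|].
  apply continuity_2d_pt_id1.
Qed.

(** This stands in for Fubini: instead of swapping a double integral, both orders are compared
    through their derivatives in the upper limit. The boundary term of Leibniz' rule vanishes
    because the primitive starts at [x = u]. *)
Lemma is_derive_RInt_primitive_kernel al T eta g x :
  0 < al -> 0 < eta -> continuity g -> 0 <= x < T ->
  is_derive (fun x => RInt (fun u => g u * primitive_kernel al T eta u x) 0 x) x
    (Rpower (T - x) (- al - 1) * RInt (fun u => Rpower (x + eta - u) (al - 1) * g u) 0 x).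
Proof.
  intros Hal Heta Hg Hx.
  set (f := fun x u => g u * primitive_kernel al T eta u x).
  set (df := fun x u => g u * (Rpower (T - x) (- al - 1) * Rpower (x - u + eta) (al - 1))).
  assert (Hd : forall y u, y < T -> u < y + eta -> is_derive (fun z => f z u) y (df y u)).
  { intros y u Hy Hu. unfold f, df.
    apply is_derive_scal, is_derive_primitive_kernel; assumption. }
  assert (Hcont : forall y u, y < T -> u < T -> u < y + eta -> continuity_pt (f y) u).
  { intros y u Hy HuT Hu. unfold f, primitive_kernel.
    apply continuity_pt_mult; [apply Hg|].
    apply continuity_pt_mult.
    - apply continuity_pt_minus; apply continuity_pt_mult.
      + apply (continuity_pt_comp (fun u => y - u + eta) (fun z => Rpower z al)).
        * apply ex_derive_continuity_pt.
          auto_derive; exact I.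
        * apply continuity_pt_Rpower; lra.
      + apply continuity_pt_const; intros ? ?; reflexivity.
      + apply continuity_pt_const; intros ? ?; reflexivity.
      + apply (continuity_pt_comp (fun u => T - u) (fun z => Rpower z (- al))).
        * apply ex_derive_continuity_pt.
          auto_derive; exact I.
        * apply continuity_pt_Rpower; lra.
    - apply continuity_pt_inv.
      + apply ex_derive_continuity_pt.
        auto_derive; exact I.
      + apply Rgt_not_eq, Rmult_lt_0_compat; lra. }
  assert (Hdf : forall y u, y < T -> u < y + eta -> continuity_2d_pt df y u).
  { intros y u Hy Hu. unfold df.
    apply (continuity_2d_pt_mult (fun _ u => g u)); [apply continuity_2d_pt_snd, Hg|].
    apply (continuity_2d_pt_mult (fun y _ => Rpower (T - y) (- al - 1))).
    - apply (continuity_1d_2d_pt_comp (fun z => Rpower z (- al - 1)) (fun y _ => T - y)).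
      + apply continuity_pt_Rpower; lra.
      + apply (continuity_2d_pt_minus (fun _ _ => T));
          [apply continuity_2d_pt_const | apply continuity_2d_pt_id1].
    - apply (continuity_1d_2d_pt_comp (fun z => Rpower z (al - 1)) (fun y u => y - u + eta)).
      + apply continuity_pt_Rpower; lra.
      + apply continuity_2d_pt_plus; [|apply continuity_2d_pt_const].
        apply continuity_2d_pt_minus; [apply continuity_2d_pt_id1 | apply continuity_2d_pt_id2]. }
  (* The factor four is the room needed below: [u] goes up to [x + 2 e], [y] down to [x - e], and
     each spends a further [e / 2] on a neighbourhood, so that [u < y + eta] still holds. *)
  set (e := Rmin eta (T - x) / 4).
  assert (He : 0 < e) by (unfold e; apply Rdiv_lt_0_compat; [apply Rmin_glb_lt|]; lra).
  assert (Hee : 4 * e <= eta)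
    by (unfold e; pose proof (Rmin_l eta (T - x)); lra).
  assert (HeT : 4 * e <= T - x)
    by (unfold e; pose proof (Rmin_r eta (T - x)); lra).
  assert (HD : forall y u, Rabs (y - x) < e -> u <= x + 2 * e ->
             continuity_2d_pt (fun u v => Derive (fun z => f z v) u) y u).
  { intros y u Hy Hu. apply Rabs_lt_between in Hy.
    apply (continuity_2d_pt_ext_loc df); [|apply Hdf; lra].
    assert (H2 : 0 < e / 2) by lra.
    exists (mkposreal _ H2). simpl. intros y' u' Hy' Hu'.
    apply Rabs_lt_between in Hy'. apply Rabs_lt_between in Hu'.
    symmetry. apply is_derive_unique, Hd; lra. }
  assert (Hnear : forall P : R -> Prop, (forall y, Rabs (y - x) < e -> P y) -> locally x P).
  { intros P HP. exists (mkposreal _ He). intros y Hy. apply HP. exact Hy. }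
  assert (HexR : forall y p q, Rabs (y - x) < e -> p <= q -> q <= x + e -> ex_RInt (f y) p q).
  { intros y p q Hy Hpq Hq. apply Rabs_lt_between in Hy.
    apply (ex_RInt_continuous (V := R_CompleteNormedModule)). intros z Hz.
    rewrite Rmin_left, Rmax_right in Hz by exact Hpq.
    apply continuity_pt_filterlim, Hcont; lra. }
  assert (Hmain : is_derive (fun y => RInt (fun u => f y u) 0 y) x
     (RInt (fun u => Derive (fun z => f z u) x) 0 x + f x x * 1)).
  { apply (is_derive_RInt_param_bound_comp_aux3 f 0 (fun y => y) x 1).
    - apply Hnear. intros y Hy. apply HexR; lra.
    - exists (mkposreal _ He). simpl. apply Hnear. intros y Hy. apply HexR; lra.
    - apply (is_derive_id (K := R_AbsRing)).
    - exists (mkposreal _ He). simpl. apply Hnear. intros y Hy u Hu.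
      exists (df y u). apply Rabs_lt_between in Hy.
      assert (Rmax 0 (x + e) = x + e) by (apply Rmax_right; lra).
      apply Hd; lra.
    - intros u Hu. rewrite Rmin_left, Rmax_right in Hu by lra.
      apply HD; [rewrite Rminus_diag, Rabs_R0; exact He | lra].
    - exists (mkposreal _ He). simpl. intros y u Hy Hu. apply HD; [exact Hy|].
      apply Rabs_lt_between in Hu. lra.
    - apply Hcont; lra. }
  evar_last; [exact Hmain|].
  replace (f x x) with 0.
  2: { unfold f, primitive_kernel. replace (x - x + eta) with eta by ring.
       unfold Rdiv. ring. }
  rewrite Rmult_0_l, Rplus_0_r.
  assert (Hscal : is_RInt (fun u => Rpower (T - x) (- al - 1) *
                     (Rpower (x + eta - u) (al - 1) * g u)) 0 x
        (Rpower (T - x) (- al - 1) * RInt (fun u => Rpower (x + eta - u) (al - 1) * g u) 0 x)).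
  { apply (is_RInt_scal (V := R_NormedModule)). apply (RInt_correct (V := R_CompleteNormedModule)).
    eexists. apply is_RInt_frac_truncated; [exact Hal | exact Hg | lra]. }
  rewrite <- (is_RInt_unique _ _ _ _ Hscal).
  apply RInt_ext. intros u Hu. rewrite Rmin_left, Rmax_right in Hu by lra.
  transitivity (df x u); [apply is_derive_unique, Hd; lra|].
  change (df x u = Rpower (T - x) (- al - 1) * (Rpower (x + eta - u) (al - 1) * g u)).
  unfold df. replace (x - u + eta) with (x + eta - u) by ring. ring.
Qed.

Lemma continuous_weighted_frac al T g x p : 0 < al -> continuity g -> x < T ->
  continuous (fun s => Rpower (T - s) p * frac al g s) x.
Proof.
  intros Hal Hg Hx. apply continuity_pt_filterlim.
  apply continuity_pt_mult; [|apply continuity_frac; assumption].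
  apply (continuity_pt_comp (fun s => T - s) (fun y => Rpower y p)).
  - apply ex_derive_continuity_pt.
    auto_derive; exact I.
  - apply continuity_pt_Rpower; lra.
Qed.

Lemma is_derive_RInt_weighted_frac al T g x p :
  0 < al -> continuity g -> 0 <= x < T ->
  is_derive (fun x => RInt (fun s => Rpower (T - s) p * frac al g s) 0 x) x
    (Rpower (T - x) p * frac al g x).
Proof.
  intros Hal Hg Hx.
  apply (is_derive_RInt (V := R_NormedModule) (fun s => Rpower (T - s) p * frac al g s) _ 0).
  - assert (He : 0 < T - x) by lra. exists (mkposreal _ He). intros y Hy.
    change (Rabs (y - x) < T - x) in Hy. apply Rabs_lt_between in Hy.
    apply (RInt_correct (V := R_CompleteNormedModule)).
    apply (ex_RInt_continuous (V := R_CompleteNormedModule)). intros z [_ Hz].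
    apply continuous_weighted_frac; try assumption.
    assert (Rmax 0 y < T) by (apply Rmax_lub_lt; lra). lra.
  - apply continuous_weighted_frac; tauto || lra.
Qed.

(** The shifted integral is [frac al g (x + eta)] minus its tail over [[x, x + eta]]. The tail is of
    size [eta^al], and uniform continuity of [frac al g] on a compact interval takes [x + eta] back
    to [x]; hence one [e] for all [x]. *)
Lemma frac_shift_small al g a del : 0 < al -> continuity g -> 0 < del ->
  exists e, 0 < e /\ forall eta x, 0 < eta < e -> 0 <= x <= a ->
    Rabs (RInt (fun u => Rpower (x + eta - u) (al - 1) * g u) 0 x - frac al g x) <= del.
Proof.
  intros Hal Hg Hdel.
  destruct (continuity_bounded g 0 (a + 1) Hg) as [M [HM Hb]].
  destruct (@Heine_cor2 (frac al g) 0 (a + 1)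
     (fun x _ => continuity_frac al g Hal Hg x) (mkposreal (del / 2) ltac:(lra))) as [d1 Hd1].
  simpl in Hd1.
  destruct (rpow_small al (del / 2 * al / M) Hal) as [d2 [Hd2 Hsm]].
  { apply Rdiv_lt_0_compat; [apply Rmult_lt_0_compat|]; lra. }
  exists (Rmin (Rmin d1 d2) 1).
  split. { repeat apply Rmin_glb_lt; try lra. apply cond_pos. }
  intros eta x [He0 He] Hx.
  assert (H1 : Rmin (Rmin d1 d2) 1 <= d1) by (eapply Rle_trans; apply Rmin_l).
  assert (H2 : Rmin (Rmin d1 d2) 1 <= d2)
    by (eapply Rle_trans; [apply Rmin_l | apply Rmin_r]).
  assert (H3 : Rmin (Rmin d1 d2) 1 <= 1) by apply Rmin_r.
  pose proof (frac_tail_bounds al g (x + eta) x (- M) M Hal Hg ltac:(lra)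
    (fun u Hu => Hb u ltac:(lra))) as Ht.
  assert (Hu := Hd1 (x + eta) x ltac:(lra) ltac:(lra)).
  replace (x + eta - x) with eta in * by ring.
  rewrite (Rabs_pos_eq eta) in Hu by lra. specialize (Hu ltac:(lra)).
  specialize (Hsm eta ltac:(lra)).
  assert (rpow eta al / al * M < del / 2).
  { apply Rmult_lt_reg_r with (al / M); [apply Rdiv_lt_0_compat; lra|].
    replace (rpow eta al / al * M * (al / M)) with (rpow eta al) by (field; lra).
    replace (del / 2 * (al / M)) with (del / 2 * al / M) by (field; lra). exact Hsm. }
  apply Rabs_lt_between in Hu. apply Rabs_le. lra.
Qed.

(** With the order of integration exchanged, the inner integral of [(T-s)^(-al-1) (s-u)^(al-1)] over
    [[u,a]] is elementary. The two sides are compared at a shift [eta > 0], with an error that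
    vanishes as [eta] tends to zero. *)
Lemma RInt_weighted_frac al T g a :
  0 < al -> continuity g -> 0 < a < T ->
  RInt (fun s => Rpower (T - s) (- al - 1) * frac al g s) 0 a =
  RInt (fun u => g u * (rpow (a - u) al * Rpower (T - a) (- al) / (al * (T - u)))) 0 a.
Proof.
  intros Hal Hg Ha.
  set (H := fun x => RInt (fun s => Rpower (T - s) (- al - 1) * frac al g s) 0 x).
  (* With [rpow] in place of [Rpower], the closed form of [primitive_kernel] at [x = a] acquires a
     meaning at [eta = 0] and is continuous there, even where [u = a]; this permits the limit. *)
  set (F := fun eta u => g u *
    ((rpow (a - u + eta) al * Rpower (T - a) (- al) - rpow eta al * Rpower (T - u) (- al))
     / (al * (T - u + eta)))).
  assert (HF0 : RInt (fun u => g u * (rpow (a - u) al * Rpower (T - a) (- al) / (al * (T - u)))) 0 a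
                = RInt (F 0) 0 a).
  { apply RInt_ext. intros u _. unfold F. rewrite (rpow_nonpos 0) by lra.
    rewrite !Rplus_0_r, Rmult_0_l, Rminus_0_r. reflexivity. }
  rewrite HF0.
  assert (HFc : continuity_pt (fun eta => RInt (F eta) 0 a) 0).
  { apply (RInt_param_continuity_pt F 0 a 0 ((T - a) / 2)); try lra.
    intros x y Hx Hy. unfold F, Rdiv.
    apply (continuity_2d_pt_mult (fun _ u => g u)); [apply continuity_2d_pt_snd, Hg|].
    apply (continuity_2d_pt_mult (fun eta u => rpow (a - u + eta) al * Rpower (T - a) (- al)
       - rpow eta al * Rpower (T - u) (- al))).
    - apply continuity_2d_pt_minus; apply continuity_2d_pt_mult.
      + apply (continuity_1d_2d_pt_comp (fun z => rpow z al) (fun eta u => a - u + eta)).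
        * apply continuity_rpow, Hal.
        * apply continuity_2d_pt_plus; [|apply continuity_2d_pt_id1].
          apply continuity_2d_pt_minus; [apply continuity_2d_pt_const | apply continuity_2d_pt_id2].
      + apply continuity_2d_pt_const.
      + apply (continuity_2d_pt_fst (fun z => rpow z al)), continuity_rpow, Hal.
      + apply (continuity_1d_2d_pt_comp (fun z => Rpower z (- al)) (fun eta u => T - u)).
        * apply continuity_pt_Rpower; lra.
        * apply continuity_2d_pt_minus; [apply continuity_2d_pt_const | apply continuity_2d_pt_id2].
    - apply (continuity_2d_pt_inv (fun eta u => al * (T - u + eta))).
      + apply continuity_2d_pt_mult; [apply continuity_2d_pt_const|].
        apply continuity_2d_pt_plus; [|apply continuity_2d_pt_id1].
        apply continuity_2d_pt_minus; [apply continuity_2d_pt_const | apply continuity_2d_pt_id2].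
      + apply Rgt_not_eq, Rmult_lt_0_compat; lra. }
  apply cond_eq. intros eps Heps.
  set (W := Rpower (T - a) (- al - 1)).
  assert (HW : 0 < W) by apply Rpower_gt0.
  assert (HWa : 0 < W * a) by (apply Rmult_lt_0_compat; lra).
  destruct (frac_shift_small al g a (eps / 2 / (W * a)) Hal Hg) as [e1 [He1 Hs]].
  { apply Rdiv_lt_0_compat; lra. }
  destruct (HFc (eps / 2) ltac:(lra)) as [e2 [He2 HF2]].
  simpl in HF2. unfold Rdist in HF2.
  set (eta := Rmin e1 e2 / 2).
  assert (Heta : 0 < eta) by (apply Rdiv_lt_0_compat; [apply Rmin_glb_lt|]; lra).
  assert (Heta1 : eta < e1) by (unfold eta in *; pose proof (Rmin_l e1 e2); lra).
  assert (Heta2 : eta < e2) by (unfold eta in *; pose proof (Rmin_r e1 e2); lra).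
  assert (K2 : Rabs (RInt (F eta) 0 a - RInt (F 0) 0 a) < eps / 2).
  { apply HF2. split; [split; [exact I | lra]|].
    rewrite Rminus_0_r, Rabs_pos_eq; lra. }
  set (G := fun x => RInt (fun u => g u * primitive_kernel al T eta u x) 0 x).
  assert (HG : RInt (F eta) 0 a = G a).
  { unfold G. apply RInt_ext. intros u Hu. rewrite Rmin_left, Rmax_right in Hu by lra.
    unfold F, primitive_kernel. rewrite !rpow_pos by lra. reflexivity. }
  set (dif := fun x => Rpower (T - x) (- al - 1) *
     (RInt (fun u => Rpower (x + eta - u) (al - 1) * g u) 0 x - frac al g x)).
  assert (Hder : forall x, 0 <= x <= a -> is_derive (fun x => G x - H x) x (dif x)).
  { intros x Hx. unfold dif. rewrite Rmult_minus_distr_l.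
    exact (is_derive_minus (V := R_NormedModule) G H x _ _
      (is_derive_RInt_primitive_kernel al T eta g x Hal Heta Hg ltac:(lra))
      (is_derive_RInt_weighted_frac al T g x (- al - 1) Hal Hg ltac:(lra))). }
  (* [G] and [H] agree at [0], so their gap at [a] is at most [a] times a bound for [dif]. The
     weight in [dif] is at most [W] because [T - x] is at least [T - a]. *)
  destruct (MVT_gen (fun x => G x - H x) 0 a dif) as [c [Hc Hmv]].
  { intros x Hx. rewrite Rmin_left, Rmax_right in Hx by lra. apply Hder; lra. }
  { intros x Hx. rewrite Rmin_left, Rmax_right in Hx by lra.
    apply ex_derive_continuity_pt.
    eexists; apply Hder; lra. }
  rewrite Rmin_left, Rmax_right in Hc by lra.
  assert (HGH0 : G 0 - H 0 = 0).
  { unfold G, H. rewrite !RInt_point. unfold zero; simpl. ring. }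
  rewrite HGH0, !Rminus_0_r in Hmv.
  specialize (Hs eta c ltac:(lra) Hc).
  assert (Hdif : Rabs (dif c) <= eps / 2 / a).
  { unfold dif. rewrite Rabs_mult, Rabs_pos_eq by apply Rlt_le, Rpower_gt0.
    replace (eps / 2 / a) with (W * (eps / 2 / (W * a))) by (field; lra).
    apply Rmult_le_compat; try apply Rabs_pos; try apply Rlt_le, Rpower_gt0; [|exact Hs].
    apply Rpower_le_neg; lra. }
  assert (HGH : Rabs (G a - H a) <= eps / 2).
  { rewrite Hmv, Rabs_mult, (Rabs_pos_eq a) by lra.
    replace (eps / 2) with (eps / 2 / a * a) by (field; lra).
    apply Rmult_le_compat_r; lra. }
  fold (H a). rewrite HG in K2.
  replace (H a - RInt (F 0) 0 a) with (- (G a - H a) + (G a - RInt (F 0) 0 a)) by ring.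
  eapply Rle_lt_trans; [apply Rabs_triang|]. rewrite Rabs_Ropp. lra.
Qed.

(** * A Fermat principle for fractional integrals *)

Lemma RInt_ext_le (f g : R -> R) a b : a <= b ->
  (forall x, a < x < b -> f x = g x) -> RInt f a b = RInt g a b.
Proof.
  intros Hab H. apply RInt_ext. intros x. rewrite Rmin_left, Rmax_right by exact Hab. apply H.
Qed.

Lemma RInt_Rmult_l (f : R -> R) a b c : ex_RInt f a b ->
  RInt (fun x => c * f x) a b = c * RInt f a b.
Proof. exact (RInt_scal (V := R_CompleteNormedModule) f a b c). Qed.

Lemma RInt_Rminus (f g : R -> R) a b : ex_RInt f a b -> ex_RInt g a b ->
  RInt (fun x => f x - g x) a b = RInt f a b - RInt g a b.
Proof. exact (RInt_minus (V := R_CompleteNormedModule) f g a b). Qed.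

Lemma RInt_Rplus (f g : R -> R) a b : ex_RInt f a b -> ex_RInt g a b ->
  RInt (fun x => f x + g x) a b = RInt f a b + RInt g a b.
Proof. exact (RInt_plus (V := R_CompleteNormedModule) f g a b). Qed.

Lemma continuous_Rpower_sub T p s : s < T -> continuous (fun s => Rpower (T - s) p) s.
Proof.
  intros H. apply continuity_pt_filterlim.
  apply (continuity_pt_comp (fun s => T - s) (fun y => Rpower y p)).
  - apply ex_derive_continuity_pt. auto_derive; exact I.
  - apply continuity_pt_Rpower; lra.
Qed.

Lemma ex_RInt_Rpower_sub T p a b : a <= b < T -> ex_RInt (fun s => Rpower (T - s) p) a b.
Proof.
  intros H. apply (ex_RInt_continuous (V := R_CompleteNormedModule)). intros z Hz.
  rewrite Rmin_left, Rmax_right in Hz by lra. apply continuous_Rpower_sub; lra.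
Qed.

Lemma RInt_Rpower_sub T p a b : p <> 0 -> a <= b < T ->
  RInt (fun s => Rpower (T - s) (p - 1)) a b = (Rpower (T - a) p - Rpower (T - b) p) / p.
Proof.
  intros Hp H. apply is_RInt_unique.
  replace ((Rpower (T - a) p - Rpower (T - b) p) / p)
    with (minus (- / p * Rpower (T - b) p) (- / p * Rpower (T - a) p))
    by (unfold minus, plus, opp; simpl; field; exact Hp).
  apply (is_RInt_derive (V := R_CompleteNormedModule) (fun s => - / p * Rpower (T - s) p)).
  - intros x Hx. rewrite Rmin_left, Rmax_right in Hx by lra.
    assert (Hd : is_derive (fun s => Rpower (T - s) p) x (-1 * (p * Rpower (T - x) (p - 1)))).
    { apply (is_derive_comp (fun y => Rpower y p) (fun s => T - s)).
      - apply is_derive_Rpower; lra.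
      - auto_derive; [exact I | ring]. }
    evar_last; [exact (is_derive_scal _ _ (- / p) _ Hd)|].
    field. exact Hp.
  - intros x Hx. rewrite Rmin_left, Rmax_right in Hx by lra.
    apply continuous_Rpower_sub; lra.
Qed.

Lemma Rpower_pred x p : 0 < x -> Rpower x p = Rpower x (p - 1) * x.
Proof.
  intros Hx. rewrite <- (Rpower_1 x) at 3 by exact Hx.
  rewrite <- Rpower_plus. f_equal. ring.
Qed.

(** Concavity of the power: its chord over [[y,x]] is no steeper than its chord over [[0,x]], whose
    slope is [x^(al-1)]. Unlike the tangent slope at [y], this stays finite at [y = 0]. *)
Lemma Rpower_rpow_gap al x y : 0 < al < 1 -> 0 < x -> 0 <= y <= x ->
  0 <= Rpower x al - rpow y al <= (x - y) * Rpower x (al - 1).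
Proof.
  intros Hal Hx Hy. rewrite <- (rpow_pos x) by exact Hx. split.
  - pose proof (rpow_le y x al ltac:(lra) ltac:(lra)). lra.
  - rewrite rpow_pos, (Rpower_pred x al) by exact Hx.
    assert (y * Rpower x (al - 1) <= rpow y al); [|lra].
    destruct (Rle_lt_dec y 0) as [H|H].
    + replace y with 0 by lra. rewrite rpow_nonpos; lra.
    + rewrite rpow_pos, (Rpower_pred y al), Rmult_comm by exact H.
      apply Rmult_le_compat_r; [lra|]. apply Rpower_le_neg; lra.
Qed.

(* The left-hand side is the integral of [g] against an approximate identity
   at [t], which has bounded mass. *)
Lemma marchaud_upper al g t a bet M c :
  0 < al < 1 -> continuity g -> 0 <= c <= a -> 0 < a < t -> 0 <= bet -> 0 <= M ->
  (forall u, c <= u <= t -> g u <= bet) -> (forall u, 0 <= u <= t -> - M <= g u <= M) ->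
  Rpower (t - a) (- al) * frac al g t
  - al * RInt (fun s => Rpower (t - s) (- al - 1) * frac al g s) 0 a
  <= bet * (/ al + / (1 - al)) + M * t * Rpower (t - c) (al - 2) * Rpower (t - a) (1 - al).
Proof.
  intros Hal Hg Hc Ha Hbet HM Hgb HgM.
  rewrite (RInt_weighted_frac al t g a) by (try assumption; lra).
  set (e := t - a). assert (He : 0 < e) by (unfold e; lra).
  set (q := fun u => g u * (rpow (a - u) al / (t - u))).
  set (k := fun u => Rpower (t - u) (al - 1) * g u).
  assert (Hq : ex_RInt q 0 a).
  { apply (ex_RInt_continuous (V := R_CompleteNormedModule)). intros u Hu.
    rewrite Rmin_left, Rmax_right in Hu by lra. apply continuity_pt_filterlim.
    apply continuity_pt_mult; [apply Hg|]. apply continuity_pt_mult.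
    - apply (continuity_pt_comp (fun u => a - u) (fun z => rpow z al)).
      + apply ex_derive_continuity_pt. auto_derive; exact I.
      + apply continuity_rpow; lra.
    - apply continuity_pt_inv; [|lra].
      apply ex_derive_continuity_pt. auto_derive; exact I. }
  assert (Hk : ex_RInt k 0 a).
  { eexists. apply is_RInt_frac_truncated; try assumption; lra. }
  replace (RInt (fun u => g u * (rpow (a - u) al * Rpower e (- al) / (al * (t - u)))) 0 a)
    with (Rpower e (- al) / al * RInt q 0 a).
  2: { rewrite <- (RInt_Rmult_l q) by exact Hq. apply RInt_ext_le; [lra|]. intros u Hu.
       unfold q. field. lra. }
  pose proof (frac_tail_bounds al g t a (- M) bet ltac:(lra) Hg ltac:(lra)) as Ht.
  destruct Ht as [_ Ht].
  { intros u Hu. split; [apply HgM | apply Hgb]; lra. }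
  fold k e in Ht.
  (* The two kernels differ by [psi >= 0], of size at most [e (t-u)^(al-2)], which concentrates at
     [t]. From [c] on, [g <= bet] and the mass is at most [e^al / (1-al)]; before [c] only [M]
     bounds [g], but there [psi] is at most [e (t-c)^(al-2)], with a full factor [e]. *)
  assert (Hpsi : RInt (fun u => k u - q u) 0 a
     <= bet * (e * (Rpower e (al - 1) / (1 - al))) + M * t * e * Rpower (t - c) (al - 2)).
  { set (m := M * e * Rpower (t - c) (al - 2)).
    assert (Hm : 0 <= m).
    { unfold m. apply Rmult_le_pos; [apply Rmult_le_pos; lra|]. apply Rlt_le, Rpower_gt0. }
    apply Rle_trans with (RInt (fun u => bet * e * Rpower (t - u) (al - 1 - 1) + m) 0 a).
    - apply RInt_le; [lra | | |].
      + apply (ex_RInt_minus (V := R_NormedModule)); assumption.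
      + apply (ex_RInt_plus (V := R_NormedModule)); [|apply ex_RInt_const].
        apply (ex_RInt_scal (V := R_NormedModule)). apply ex_RInt_Rpower_sub; lra.
      + intros u Hu. unfold k, q.
        set (psi := (Rpower (t - u) al - rpow (a - u) al) / (t - u)).
        replace (Rpower (t - u) (al - 1) * g u - g u * (rpow (a - u) al / (t - u)))
          with (g u * psi).
        2: { unfold psi. rewrite (Rpower_pred (t - u) al) by lra. field. lra. }
        destruct (Rpower_rpow_gap al (t - u) (a - u) Hal ltac:(lra) ltac:(lra)) as [G1 G2].
        replace (t - u - (a - u)) with e in G2 by (unfold e; ring).
        assert (P1 : 0 <= psi) by (apply Rdiv_le_0_compat; lra).
        assert (P2 : psi <= e * Rpower (t - u) (al - 1 - 1)).
        { unfold psi. apply Rmult_le_reg_r with (t - u); [lra|].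
          unfold Rdiv. rewrite !Rmult_assoc, Rinv_l, Rmult_1_r by lra.
          rewrite <- Rpower_pred by lra. exact G2. }
        assert (P3 : 0 <= e * Rpower (t - u) (al - 1 - 1)) by lra.
        destruct (Rle_lt_dec c u) as [Huc|Huc].
        * assert (g u <= bet) by (apply Hgb; lra).
          assert (g u * psi <= bet * psi) by (apply Rmult_le_compat_r; assumption).
          assert (bet * psi <= bet * (e * Rpower (t - u) (al - 1 - 1)))
            by (apply Rmult_le_compat_l; assumption).
          lra.
        * assert (g u <= M) by (apply HgM; lra).
          assert (g u * psi <= M * psi) by (apply Rmult_le_compat_r; assumption).
          assert (M * psi <= M * (e * Rpower (t - u) (al - 1 - 1)))
            by (apply Rmult_le_compat_l; assumption).
          assert (Rpower (t - u) (al - 1 - 1) <= Rpower (t - c) (al - 2)).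
          { replace (al - 1 - 1) with (al - 2) by ring. apply Rpower_le_neg; lra. }
          assert (M * (e * Rpower (t - u) (al - 1 - 1)) <= m).
          { unfold m. rewrite Rmult_assoc. apply Rmult_le_compat_l; [lra|].
            apply Rmult_le_compat_l; lra. }
          assert (0 <= bet * (e * Rpower (t - u) (al - 1 - 1)))
            by (apply Rmult_le_pos; assumption).
          lra.
    - rewrite RInt_Rplus.
      2: { apply (ex_RInt_scal (V := R_NormedModule)). apply ex_RInt_Rpower_sub; lra. }
      2: apply ex_RInt_const.
      rewrite RInt_Rmult_l by (apply ex_RInt_Rpower_sub; lra).
      rewrite RInt_Rpower_sub by lra. fold e.
      rewrite RInt_const. unfold scal; simpl; unfold mult; simpl.
      rewrite Rmult_assoc. apply Rplus_le_compat.
      + apply Rmult_le_compat_l; [exact Hbet|]. apply Rmult_le_compat_l; [lra|].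
        replace ((Rpower (t - 0) (al - 1) - Rpower e (al - 1)) / (al - 1))
          with (Rpower e (al - 1) / (1 - al) - Rpower (t - 0) (al - 1) / (1 - al))
          by (field; lra).
        assert (0 <= Rpower (t - 0) (al - 1) / (1 - al))
          by (apply Rdiv_le_0_compat; [apply Rlt_le, Rpower_gt0 | lra]).
        lra.
      + unfold m in *. replace (M * t * e * Rpower (t - c) (al - 2))
          with (t * (M * e * Rpower (t - c) (al - 2))) by ring.
        apply Rmult_le_compat_r; lra. }
  rewrite RInt_Rminus in Hpsi by assumption.
  assert (Hea : Rpower e (- al) * Rpower e al = 1).
  { rewrite <- Rpower_plus. replace (- al + al) with 0 by ring. apply Rpower_O; lra. }
  assert (He1 : Rpower e (1 - al) = Rpower e (- al) * e).
  { rewrite (Rpower_pred e (1 - al)) by lra. do 2 f_equal. ring. }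
  replace (Rpower e (- al) * frac al g t - al * (Rpower e (- al) / al * RInt q 0 a))
    with (Rpower e (- al) * (frac al g t - RInt q 0 a)) by (field; lra).
  rewrite He1.
  rewrite rpow_pos in Ht by exact He.
  apply Rle_trans with (Rpower e (- al) * (Rpower e al / al * bet
     + (bet * (e * (Rpower e (al - 1) / (1 - al))) + M * t * e * Rpower (t - c) (al - 2)))).
  { apply Rmult_le_compat_l; [apply Rlt_le, Rpower_gt0 | lra]. }
  right.
  replace (e * (Rpower e (al - 1) / (1 - al))) with (Rpower e al / (1 - al))
    by (rewrite (Rpower_pred e al) by exact He; field; lra).
  replace (bet * (/ al + / (1 - al)))
    with (Rpower e (- al) * Rpower e al * (bet * (/ al + / (1 - al)))) by (rewrite Hea; ring).
  field. lra.
Qed.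

(** Up to an error vanishing with the truncation, the Marchaud derivative at [t] is at most a
    positive multiple of an upper bound of [g] near [t], so [g t <= 0] leaves no positive part. The
    term [t^(-al) frac al g t] is the contribution of the missing history before time zero. *)
Lemma frac_fermat al g t A :
  0 < al < 1 -> continuity g -> 0 < t -> g t <= 0 ->
  (forall a, 0 < a < t ->
     al * RInt (fun s => Rpower (t - s) (- al - 1) * (frac al g s - frac al g t)) 0 a <= A) ->
  Rpower t (- al) * frac al g t <= A.
Proof.
  intros Hal Hg Ht Hgt HA.
  apply le_epsilon. intros del Hdel.
  destruct (continuity_bounded g 0 t Hg) as [M [HM HgM]].
  set (K := / al + / (1 - al)).
  assert (HK : 0 < K).
  { unfold K. apply Rplus_lt_0_compat; apply Rinv_0_lt_compat; lra. }
  (* Half of the slack [del] pays for [bet], granted near [t] by continuity and [g t <= 0]; the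
     other half pays for the remainder [P e^(1-al)]. The order matters: [c] and [P] are fixed before
     [e]. *)
  set (bet := del / 2 / K).
  assert (Hbet : 0 < bet) by (apply Rdiv_lt_0_compat; lra).
  destruct (Hg t bet Hbet) as [z [Hz Hgz]]. simpl in Hgz. unfold Rdist in Hgz.
  set (c := Rmax 0 (t - z / 2)).
  assert (Hc0 : 0 <= c) by apply Rmax_l.
  assert (Hct : c < t) by (apply Rmax_lub_lt; lra).
  assert (Hcz : t - z / 2 <= c) by apply Rmax_r.
  assert (Hgb : forall u, c <= u <= t -> g u <= bet).
  { intros u Hu. destruct (Req_dec t u) as [E|E]; [subst; lra|].
    assert (Hu' : Rabs (g u - g t) < bet).
    { apply Hgz. split; [split; [exact I | exact E]|]. apply Rabs_def1; lra. }
    apply Rabs_lt_between in Hu'. lra. }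
  set (P := M * t * Rpower (t - c) (al - 2)).
  assert (HP : 0 < P).
  { unfold P. apply Rmult_lt_0_compat; [apply Rmult_lt_0_compat; lra | apply Rpower_gt0]. }
  destruct (rpow_small (1 - al) (del / 2 / P) ltac:(lra)) as [d [Hd Hsm]].
  { apply Rdiv_lt_0_compat; lra. }
  set (e := Rmin d (t - c) / 2).
  assert (He : 0 < e) by (apply Rdiv_lt_0_compat; [apply Rmin_glb_lt|]; lra).
  assert (Hed : e < d) by (unfold e in *; pose proof (Rmin_l d (t - c)); lra).
  assert (Hec : e < t - c) by (unfold e in *; pose proof (Rmin_r d (t - c)); lra).
  pose proof (marchaud_upper al g t (t - e) bet M c Hal Hg ltac:(lra) ltac:(lra)
     ltac:(lra) ltac:(lra) Hgb HgM) as HU.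
  replace (t - (t - e)) with e in HU by ring.
  specialize (HA (t - e) ltac:(lra)). specialize (Hsm e Hed).
  rewrite rpow_pos in Hsm by exact He. fold K P in HU.
  assert (HPe : P * Rpower e (1 - al) < del / 2).
  { apply Rmult_lt_reg_r with (/ P); [apply Rinv_0_lt_compat, HP|].
    replace (P * Rpower e (1 - al) * / P) with (Rpower e (1 - al)) by (field; lra). exact Hsm. }
  assert (HbK : bet * K = del / 2) by (unfold bet; field; lra).
  assert (HI : RInt (fun s => Rpower (t - s) (- al - 1) * (frac al g s - frac al g t)) 0 (t - e)
     = RInt (fun s => Rpower (t - s) (- al - 1) * frac al g s) 0 (t - e)
       - frac al g t * ((Rpower e (- al) - Rpower t (- al)) / al)).
  { assert (HR : (Rpower e (- al) - Rpower t (- al)) / al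
      = RInt (fun s => Rpower (t - s) (- al - 1)) 0 (t - e)).
    { rewrite RInt_Rpower_sub by lra.
      replace (t - (t - e)) with e by ring. rewrite Rminus_0_r. field. lra. }
    rewrite HR, <- RInt_Rmult_l by (apply ex_RInt_Rpower_sub; lra).
    rewrite <- RInt_Rminus.
    - apply RInt_ext_le; [lra|]. intros s _. ring.
    - apply (ex_RInt_continuous (V := R_CompleteNormedModule)). intros s Hs.
      rewrite Rmin_left, Rmax_right in Hs by lra.
      apply continuous_weighted_frac; try assumption; lra.
    - apply (ex_RInt_scal (V := R_NormedModule)). apply ex_RInt_Rpower_sub; lra. }
  (* The terms [frac al g t * e^(-al)], unbounded as [e] shrinks, cancel between [HA] and [HU]; only
     the one with [t^(-al)] survives. *)
  rewrite HI in HA.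
  replace (al * (RInt (fun s => Rpower (t - s) (- al - 1) * frac al g s) 0 (t - e)
      - frac al g t * ((Rpower e (- al) - Rpower t (- al)) / al)))
    with (al * RInt (fun s => Rpower (t - s) (- al - 1) * frac al g s) 0 (t - e)
      - frac al g t * Rpower e (- al) + Rpower t (- al) * frac al g t) in HA by (field; lra).
  lra.
Qed.

(** * Euclidean vectors *)

Lemma fsum_ext d (u v : Fin.t d -> R) : (forall i, u i = v i) -> fsum d u = fsum d v.
Proof.
  intros H. f_equal. apply functional_extensionality, H.
Qed.

Lemma fsum_plus d (u v : Fin.t d -> R) : fsum d (fun i => u i + v i) = fsum d u + fsum d v.
Proof. induction d as [|d IH]; simpl; [ring|]. rewrite IH. ring. Qed.

Lemma fsum_scal d c (u : Fin.t d -> R) : fsum d (fun i => c * u i) = c * fsum d u.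
Proof. induction d as [|d IH]; simpl; [ring|]. rewrite IH. ring. Qed.

Lemma fsum_le d (u v : Fin.t d -> R) : (forall i, u i <= v i) -> fsum d u <= fsum d v.
Proof.
  induction d as [|d IH]; intros H; simpl; [lra|].
  apply Rplus_le_compat; [apply H | apply IH; intros i; apply H].
Qed.

Lemma fsum_const d c : fsum d (fun _ => c) = INR d * c.
Proof.
  induction d as [|d IH]; [simpl; ring|]. rewrite S_INR. simpl. rewrite IH. ring.
Qed.

Lemma fsum_ge0 d (u : Fin.t d -> R) : (forall i, 0 <= u i) -> 0 <= fsum d u.
Proof. intros H. rewrite <- (Rmult_0_r (INR d)), <- fsum_const. apply fsum_le, H. Qed.

Lemma fsum_ge_term d (u : Fin.t d -> R) i : (forall j, 0 <= u j) -> u i <= fsum d u.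
Proof.
  intros H. induction i as [d|d i IH]; simpl.
  - pose proof (fsum_ge0 d (fun j => u (Fin.FS j)) (fun j => H _)). lra.
  - pose proof (H Fin.F1). pose proof (IH (fun j => u (Fin.FS j)) (fun j => H _)). simpl in *. lra.
Qed.

Lemma continuity_fsum d (F : Fin.t d -> R -> R) :
  (forall i, continuity (F i)) -> continuity (fun t => fsum d (fun i => F i t)).
Proof.
  induction d as [|d IH]; intros H; simpl.
  - apply continuity_const; intros ? ?; reflexivity.
  - apply (continuity_plus (F Fin.F1)); [apply H|].
    apply (IH (fun i => F (Fin.FS i))). intros i; apply H.
Qed.

Lemma frac_fsum al d (F : Fin.t d -> R -> R) t :
  0 < al -> (forall i, continuity (F i)) ->
  frac al (fun s => fsum d (fun i => F i s)) t = fsum d (fun i => frac al (F i) t).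
Proof.
  intros Hal. induction d as [|d IH]; intros H; simpl.
  - rewrite frac_const. ring.
  - rewrite frac_plus; [| exact Hal | apply H |].
    + f_equal. apply IH. intros i; apply H.
    + apply (continuity_fsum d (fun i => F (Fin.FS i))). intros i; apply H.
Qed.

Lemma dot_ge0 d (x : vec d) : 0 <= dot x x.
Proof. apply fsum_ge0. intros i. apply Rle_0_sqr. Qed.

Lemma norm_ge0 d (x : vec d) : 0 <= norm x.
Proof. apply sqrt_pos. Qed.

Lemma abs_le_norm d (x : vec d) i : Rabs (x i) <= norm x.
Proof.
  unfold norm. rewrite <- sqrt_Rsqr_abs. apply sqrt_le_1_alt.
  apply (fsum_ge_term d (fun i => x i * x i)). intros j. apply Rle_0_sqr.
Qed.

Lemma norm_le_sum d (x : vec d) : norm x <= fsum d (fun i => Rabs (x i)).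
Proof.
  unfold norm.
  assert (H : forall u : Fin.t d -> R, (forall i, 0 <= u i) ->
     fsum d (fun i => u i * u i) <= Rsqr (fsum d u)).
  { clear x. induction d as [|d IH]; intros u Hu; simpl; unfold Rsqr in *; [lra|].
    pose proof (IH (fun i => u (Fin.FS i)) (fun i => Hu _)) as H.
    pose proof (fsum_ge0 d (fun i => u (Fin.FS i)) (fun i => Hu _)).
    pose proof (Hu Fin.F1). nra. }
  rewrite <- (sqrt_Rsqr (fsum d (fun i => Rabs (x i)))) by (apply fsum_ge0; intros i; apply Rabs_pos).
  apply sqrt_le_1_alt. eapply Rle_trans; [|apply H; intros i; apply Rabs_pos].
  right. apply fsum_ext. intros i. rewrite <- Rabs_mult. symmetry. apply Rabs_pos_eq, Rle_0_sqr.
Qed.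

Lemma norm_le_dim d (x : vec d) c : (forall i, Rabs (x i) <= c) -> norm x <= INR d * c.
Proof.
  intros H. eapply Rle_trans; [apply norm_le_sum|]. rewrite <- fsum_const. apply fsum_le, H.
Qed.

Lemma norm_vscal d l (x : vec d) : 0 <= l -> norm (vscal l x) = l * norm x.
Proof.
  intros Hl. unfold norm. rewrite <- (sqrt_Rsqr l) at 3 by exact Hl.
  rewrite <- sqrt_mult_alt by apply Rle_0_sqr. f_equal. unfold dot, vscal, Rsqr.
  rewrite <- fsum_scal. apply fsum_ext. intros i. ring.
Qed.

Lemma dot_vscal d p l (x : vec d) : dot p (vscal l x) = l * dot p x.
Proof. unfold dot, vscal. rewrite <- fsum_scal. apply fsum_ext. intros i. ring. Qed.

Lemma dot_vsub d p (x y : vec d) : dot p (vsub x y) = dot p x - dot p y.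
Proof.
  unfold dot, vsub.
  replace (fsum d (fun i => p i * x i) - fsum d (fun i => p i * y i))
    with (fsum d (fun i => p i * x i) + -1 * fsum d (fun i => p i * y i)) by ring.
  rewrite <- fsum_scal, <- fsum_plus. apply fsum_ext. intros i. ring.
Qed.

Lemma abs_dot_le d (p x : vec d) : Rabs (dot p x) <= fsum d (fun i => Rabs (p i)) * norm x.
Proof.
  assert (H : Rabs (dot p x) <= fsum d (fun i => Rabs (p i) * norm x)).
  { unfold dot. apply Rabs_le. split.
    - replace (- fsum d (fun i => Rabs (p i) * norm x))
        with (fsum d (fun i => -1 * (Rabs (p i) * norm x))) by (rewrite fsum_scal; ring).
      apply fsum_le. intros i.
      assert (Hi : Rabs (p i * x i) <= Rabs (p i) * norm x)
        by (rewrite Rabs_mult; apply Rmult_le_compat_l; [apply Rabs_pos | apply abs_le_norm]).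
      apply Rabs_le_between in Hi. lra.
    - apply fsum_le. intros i.
      assert (Hi : Rabs (p i * x i) <= Rabs (p i) * norm x)
        by (rewrite Rabs_mult; apply Rmult_le_compat_l; [apply Rabs_pos | apply abs_le_norm]).
      apply Rabs_le_between in Hi. lra. }
  rewrite Rmult_comm, <- fsum_scal.
  rewrite (fsum_ext d (fun i => norm x * Rabs (p i)) (fun i => Rabs (p i) * norm x)); [exact H|].
  intros i. ring.
Qed.

Definition vcontinuity {d} (y : R -> vec d) : Prop :=
  forall i, continuity (fun t => y t i).

Lemma continuity_norm d (y : R -> vec d) : vcontinuity y -> continuity (fun t => norm (y t)).
Proof.
  intros H t. unfold norm.
  apply (continuity_pt_comp (fun t => dot (y t) (y t)) sqrt).
  - apply (continuity_fsum d (fun i t => y t i * y t i)). intros i.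
    apply (continuity_mult (fun t => y t i) (fun t => y t i)); apply H.
  - apply continuity_pt_sqrt, dot_ge0.
Qed.

Lemma norm_vsub_diag d (x : vec d) : norm (vsub x x) = 0.
Proof.
  unfold norm, dot, vsub. erewrite (fsum_ext d _ (fun _ => 0)).
  - rewrite fsum_const, Rmult_0_r. apply sqrt_0.
  - intros i. ring.
Qed.

Lemma vcontinuity_norm d (y : R -> vec d) t eps : vcontinuity y -> 0 < eps ->
  exists del, 0 < del /\ forall s, Rabs (s - t) < del -> norm (vsub (y s) (y t)) < eps.
Proof.
  intros H Heps.
  assert (Hc : continuity (fun s => norm (vsub (y s) (y t)))).
  { apply (continuity_norm d (fun s => vsub (y s) (y t))). intros i. unfold vsub.
    apply (continuity_minus (fun s => y s i) (fun _ => y t i)); [apply H|].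
    apply continuity_const; intros ? ?; reflexivity. }
  destruct (Hc t eps Heps) as [del [Hdel Hd]]. simpl in Hd. unfold Rdist in Hd.
  rewrite norm_vsub_diag in Hd.
  exists del. split; [exact Hdel|]. intros s Hs.
  destruct (Req_dec t s) as [E|E]; [subst; rewrite norm_vsub_diag; exact Heps|].
  specialize (Hd s (conj (conj I E) Hs)). apply Rabs_lt_between in Hd. lra.
Qed.

(** * Convex differentiable functions along curves *)

Lemma vadd_vsub d (x z : vec d) : vadd x (vsub z x) = z.
Proof. apply functional_extensionality. intros i. unfold vadd, vsub. ring. Qed.

Lemma continuity_differentiable d (V : vec d -> R) y :
  differentiable V -> vcontinuity y -> continuity (fun t => V (y t)).
Proof.
  intros HV Hy t eps Heps.
  destruct (HV (y t)) as [p Hp]. destruct (Hp 1 Rlt_0_1) as [d1 [Hd1 H1]].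
  set (K := 1 + fsum d (fun i => Rabs (p i))).
  assert (HK : 0 < K).
  { pose proof (fsum_ge0 d (fun i => Rabs (p i)) (fun i => Rabs_pos _)). unfold K. lra. }
  destruct (vcontinuity_norm d y t (Rmin d1 (eps / K)) Hy) as [del [Hdel Hd]].
  { apply Rmin_glb_lt; [exact Hd1 | apply Rdiv_lt_0_compat; lra]. }
  exists del. split; [exact Hdel|]. intros s [_ Hs]. simpl in *. unfold Rdist in *.
  specialize (Hd s Hs).
  assert (Ha : norm (vsub (y s) (y t)) < d1) by (eapply Rlt_le_trans; [exact Hd | apply Rmin_l]).
  assert (Hb : norm (vsub (y s) (y t)) < eps / K)
    by (eapply Rlt_le_trans; [exact Hd | apply Rmin_r]).
  specialize (H1 _ Ha). rewrite vadd_vsub in H1.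
  pose proof (abs_dot_le d p (vsub (y s) (y t))) as H2.
  set (n := norm (vsub (y s) (y t))) in *.
  assert (K * n < eps).
  { replace eps with (K * (eps / K)) by (field; lra). apply Rmult_lt_compat_l; assumption. }
  replace (V (y s) - V (y t))
    with ((V (y s) - V (y t) - dot p (vsub (y s) (y t))) + dot p (vsub (y s) (y t))) by ring.
  eapply Rle_lt_trans; [apply Rabs_triang|]. unfold K in *. lra.
Qed.

(** Convexity on the segment from [x] to [z] bounds the difference quotient at step [l] by
    [V z - V x]; the gradient gives its limit as [l] tends to zero. *)
Lemma convex_gradient_le d (V : vec d -> R) x z p :
  convex V -> has_gradient V x p -> dot p (vsub z x) <= V z - V x.
Proof.
  intros HV Hp. apply le_epsilon. intros eps Heps.
  set (k := vsub z x). set (n := norm k). assert (Hn : 0 <= n) by apply norm_ge0.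
  destruct (Hp (eps / (n + 1))) as [del [Hdel Hd]]; [apply Rdiv_lt_0_compat; lra|].
  set (l := Rmin 1 (del / (n + 1) / 2)).
  assert (Hq : 0 < del / (n + 1) / 2) by (repeat apply Rdiv_lt_0_compat; lra).
  assert (Hl0 : 0 < l) by (apply Rmin_glb_lt; lra).
  assert (Hl1 : l <= 1) by apply Rmin_l.
  assert (Hl2 : l * n < del).
  { apply Rle_lt_trans with (del / (n + 1) / 2 * n).
    - apply Rmult_le_compat_r; [exact Hn | apply Rmin_r].
    - replace del with (del / (n + 1) / 2 * (2 * (n + 1))) at 2 by (field; lra).
      apply Rmult_lt_compat_l; lra. }
  specialize (Hd (vscal l k)). rewrite norm_vscal in Hd by lra. specialize (Hd Hl2).
  rewrite dot_vscal in Hd. fold n in Hd.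
  assert (E : vadd x (vscal l k) = vadd (vscal l z) (vscal (1 - l) x)).
  { apply functional_extensionality. intros i. unfold vadd, vscal, k, vsub. ring. }
  rewrite E in Hd. pose proof (HV z x l ltac:(lra)) as Hc.
  apply Rabs_le_between in Hd.
  assert (He : eps / (n + 1) * n <= eps).
  { replace eps with (eps / (n + 1) * (n + 1)) at 2 by (field; lra).
    apply Rmult_le_compat_l; [apply Rlt_le, Rdiv_lt_0_compat|]; lra. }
  apply Rmult_le_reg_l with l; [exact Hl0|].
  assert (l * (eps / (n + 1) * n) <= l * eps) by (apply Rmult_le_compat_l; lra).
  lra.
Qed.

(* [h s = <p, y s>] with [p] the gradient of [V] at [y t]; convexity makes
   [V o y - h] minimal at [t], and the scalar Fermat principle applies to [h]. *)
Lemma lyapunov_fermat d al (V : vec d -> R) (y G : R -> vec d) p t del A :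
  0 < al < 1 -> convex V -> differentiable V -> vcontinuity y -> vcontinuity G -> 0 < t ->
  (forall s i, 0 <= s <= t -> y s i = y 0 i + frac al (fun u => G u i) s) ->
  has_gradient V (y t) p -> dot p (G t) <= - del -> 0 <= del ->
  (forall a, 0 < a < t ->
     al * RInt (fun s => Rpower (t - s) (- al - 1) * (V (y s) - V (y t))) 0 a <= A) ->
  Rpower t (- al) * (V (y t) - V (y 0)) + del / al <= A.
Proof.
  intros Hal HV HVd Hy HG Ht Heq Hp Hneg Hdel HA.
  (* Adding [del] uses up the strict negativity and still leaves [g t <= 0]. The fractional integral
     gains [rpow s al / al * del], which is nondecreasing in [s], hence harmless in the comparison
     with the past, and yields [del / al] at [t] after multiplication by [t^(-al)]. *)
  set (g := fun u => dot p (G u) + del).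
  assert (Hdg : continuity (fun u => dot p (G u))).
  { apply (continuity_fsum d (fun i u => p i * G u i)). intros i.
    apply (continuity_scal (fun u => G u i) (p i)), HG. }
  assert (Hg : continuity g).
  { apply (continuity_plus (fun u => dot p (G u)) (fun _ => del)); [exact Hdg|].
    apply continuity_const; intros ? ?; reflexivity. }
  assert (Hfr : forall s, 0 <= s <= t ->
     frac al g s = dot p (vsub (y s) (y 0)) + rpow s al / al * del).
  { intros s Hs. unfold g.
    rewrite (frac_plus al (fun u => dot p (G u)) (fun _ => del)).
    2: lra. 2: exact Hdg. 2: apply continuity_const; intros ? ?; reflexivity.
    rewrite frac_const. f_equal. unfold dot.
    rewrite (frac_fsum al d (fun i u => p i * G u i)).
    2: lra.
    2: { intros i. apply (continuity_scal (fun u => G u i) (p i)), HG. }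
    apply fsum_ext. intros i.
    rewrite (frac_scal al (p i) (fun u => G u i)) by (try apply HG; lra).
    unfold vsub. rewrite (Heq s i Hs). ring. }
  assert (HVy : continuity (fun s => V (y s))) by (apply continuity_differentiable; assumption).
  assert (HF : Rpower t (- al) * frac al g t <= A).
  { apply frac_fermat; [exact Hal | exact Hg | exact Ht | unfold g; lra |].
    intros a Ha. eapply Rle_trans; [|apply (HA a Ha)].
    apply Rmult_le_compat_l; [lra|]. apply RInt_le; [lra | | |].
    - apply (ex_RInt_continuous (V := R_CompleteNormedModule)). intros s Hs.
      rewrite Rmin_left, Rmax_right in Hs by lra.
      apply (continuous_mult (fun s => Rpower (t - s) (- al - 1)) (fun s => frac al g s - frac al g t)).
      + apply continuous_Rpower_sub; lra.
      + apply continuity_continuous.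
        apply (continuity_minus (frac al g) (fun _ => frac al g t)).
        * apply continuity_frac; [lra | exact Hg].
        * apply continuity_const; intros ? ?; reflexivity.
    - apply (ex_RInt_continuous (V := R_CompleteNormedModule)). intros s Hs.
      rewrite Rmin_left, Rmax_right in Hs by lra.
      apply (continuous_mult (fun s => Rpower (t - s) (- al - 1)) (fun s => V (y s) - V (y t))).
      + apply continuous_Rpower_sub; lra.
      + apply continuity_continuous.
        apply (continuity_minus (fun s => V (y s)) (fun _ => V (y t))); [exact HVy|].
        apply continuity_const; intros ? ?; reflexivity.
    - intros s Hs. apply Rmult_le_compat_l; [apply Rlt_le, Rpower_gt0|].
      rewrite !Hfr by lra.
      pose proof (convex_gradient_le d V (y t) (y s) p HV Hp) as Hc.
      rewrite !dot_vsub in *.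
      assert (rpow s al / al * del <= rpow t al / al * del).
      { apply Rmult_le_compat_r; [exact Hdel|].
        apply Rmult_le_compat_r; [apply Rlt_le, Rinv_0_lt_compat; lra|].
        apply rpow_le; lra. }
      lra. }
  rewrite Hfr, rpow_pos in HF by lra.
  (* The tangent inequality, applied to the history above, is applied once more at time zero:
     [<p, y t - y 0>] in the boundary term is at least [V (y t) - V (y 0)]. *)
  pose proof (convex_gradient_le d V (y t) (y 0) p HV Hp) as Hc.
  rewrite !dot_vsub in *.
  assert (E : Rpower t (- al) * Rpower t al = 1).
  { rewrite <- Rpower_plus. replace (- al + al) with 0 by ring. apply Rpower_O, Ht. }
  replace (del / al) with (Rpower t (- al) * Rpower t al * (del / al)) by (rewrite E; ring).
  eapply Rle_trans; [|exact HF].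
  replace (Rpower t (- al) * (V (y t) - V (y 0)) + Rpower t (- al) * Rpower t al * (del / al))
    with (Rpower t (- al) * (V (y t) - V (y 0) + Rpower t al / al * del)) by (field; lra).
  apply Rmult_le_compat_l; [apply Rlt_le, Rpower_gt0 | lra].
Qed.

(** A maximum over [[0,t1]] makes the integrand nonpositive, so [A = 0] is admissible, while the
    boundary term is positive. Only the initial value is compared, because the equation cannot be
    restarted. *)
Lemma lyapunov_nonincreasing d al (V : vec d -> R) (y G : R -> vec d) t1 :
  0 < al < 1 -> convex V -> differentiable V -> vcontinuity y -> vcontinuity G -> 0 <= t1 ->
  (forall s i, 0 <= s <= t1 -> y s i = y 0 i + frac al (fun u => G u i) s) ->
  (forall t p, 0 <= t <= t1 -> has_gradient V (y t) p -> dot p (G t) <= 0) ->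
  V (y t1) <= V (y 0).
Proof.
  intros Hal HV HVd Hy HG Ht1 Heq Hneg.
  destruct (Rle_lt_dec (V (y t1)) (V (y 0))) as [H|H]; [exact H|exfalso].
  destruct (continuity_ab_maj (fun s => V (y s)) 0 t1 Ht1) as [t [Hmax Ht]].
  { intros c _. apply continuity_differentiable; assumption. }
  assert (H1 : V (y t1) <= V (y t)) by (apply Hmax; lra).
  assert (Htpos : 0 < t).
  { destruct (Req_dec t 0) as [E|E]; [subst; lra | lra]. }
  destruct (HVd (y t)) as [p Hp].
  assert (HF : Rpower t (- al) * (V (y t) - V (y 0)) + 0 / al <= 0).
  { apply (lyapunov_fermat d al V y G p); try assumption; try lra.
    - intros s i Hs. apply Heq. lra.
    - rewrite Ropp_0. apply Hneg; assumption.
    - intros a Ha.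
      assert (HI : RInt (fun s => Rpower (t - s) (- al - 1) * (V (y s) - V (y t))) 0 a
                  <= RInt (fun _ => 0) 0 a).
      { apply RInt_le; [lra | | apply ex_RInt_const |].
        - apply (ex_RInt_continuous (V := R_CompleteNormedModule)). intros s Hs.
          rewrite Rmin_left, Rmax_right in Hs by lra.
          apply (continuous_mult (fun s => Rpower (t - s) (- al - 1)) (fun s => V (y s) - V (y t))).
          + apply continuous_Rpower_sub; lra.
          + apply continuity_continuous.
            apply (continuity_minus (fun s => V (y s)) (fun _ => V (y t)));
              [apply continuity_differentiable; assumption|].
            apply continuity_const; intros ? ?; reflexivity.
        - intros s Hs. pose proof (Rpower_gt0 (t - s) (- al - 1)).
          assert (V (y s) <= V (y t)) by (apply Hmax; lra). nra. }
      rewrite RInt_const in HI. unfold scal in HI; simpl in HI; unfold mult in HI; simpl in HI.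
      nra. }
  pose proof (Rpower_gt0 t (- al)). unfold Rdiv in HF. nra.
Qed.

(** The two caps agree at [t - s = y0]. The linear one tames the singular weight on the recent part
    and gives [al / (1 - al)], the constant one gives [1] on the older part, both in units of
    [M y0^(-al)]. The bound is free of [t] and [a] and small for large [y0]. *)
Lemma marchaud_capped al t y0 M a (om : R -> R) :
  0 < al < 1 -> 0 < y0 -> 0 < M -> 0 < a < t -> continuity om ->
  (forall s, 0 <= s <= t -> om s <= M / y0 * (t - s)) ->
  (forall s, 0 <= s <= t -> om s <= M) ->
  al * RInt (fun s => Rpower (t - s) (- al - 1) * om s) 0 a
  <= M * Rpower y0 (- al) * (al / (1 - al) + 1).
Proof.
  intros Hal Hy0 HM Ha Hom Hb1 Hb2.
  set (w := fun s => Rpower (t - s) (- al - 1) * om s).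
  set (sc := M * Rpower y0 (- al)).
  assert (Hsc : 0 < sc) by (apply Rmult_lt_0_compat; [exact HM | apply Rpower_gt0]).
  assert (Hex : forall p q, p <= q < t -> ex_RInt w p q).
  { intros p q Hpq. apply (ex_RInt_continuous (V := R_CompleteNormedModule)). intros s Hs.
    rewrite Rmin_left, Rmax_right in Hs by lra.
    apply (continuous_mult (fun s => Rpower (t - s) (- al - 1)) om).
    - apply continuous_Rpower_sub; lra.
    - apply continuity_continuous, Hom. }
  assert (Hnear : forall c, 0 <= c <= a -> t - c <= y0 -> al * RInt w c a <= sc * (al / (1 - al))).
  { intros c Hc Hcy.
    assert (HI : RInt w c a <= RInt (fun s => M / y0 * Rpower (t - s) ((1 - al) - 1)) c a).
    { apply RInt_le; [lra | apply Hex; lra | |].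
      - apply (ex_RInt_scal (V := R_NormedModule)). apply ex_RInt_Rpower_sub; lra.
      - intros s Hs. unfold w.
        replace (1 - al - 1) with (- al) by ring.
        rewrite (Rpower_pred (t - s) (- al)) by lra.
        pose proof (Rpower_gt0 (t - s) (- al - 1)).
        specialize (Hb1 s ltac:(lra)).
        replace (M / y0 * (Rpower (t - s) (- al - 1) * (t - s)))
          with (Rpower (t - s) (- al - 1) * (M / y0 * (t - s))) by ring.
        apply Rmult_le_compat_l; lra. }
    rewrite RInt_Rmult_l, RInt_Rpower_sub in HI by (try apply ex_RInt_Rpower_sub; lra).
    assert (H1 : Rpower (t - c) (1 - al) <= Rpower y0 (1 - al)) by (apply Rle_Rpower_l; lra).
    pose proof (Rpower_gt0 (t - a) (1 - al)).
    assert (H2 : sc = M / y0 * Rpower y0 (1 - al)).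
    { unfold sc. rewrite (Rpower_pred y0 (1 - al)) by lra.
      replace (1 - al - 1) with (- al) by ring. field. lra. }
    rewrite H2.
    replace (M / y0 * Rpower y0 (1 - al) * (al / (1 - al)))
      with (al * (M / y0 * (Rpower y0 (1 - al) / (1 - al)))) by (field; lra).
    apply Rmult_le_compat_l; [lra|]. eapply Rle_trans; [exact HI|].
    apply Rmult_le_compat_l; [apply Rlt_le, Rdiv_lt_0_compat; lra|].
    apply Rmult_le_compat_r; [apply Rlt_le, Rinv_0_lt_compat; lra | lra]. }
  assert (Hfar : forall c, 0 <= c <= a -> y0 <= t - c -> al * RInt w 0 c <= sc).
  { intros c Hc Hcy.
    assert (HI : RInt w 0 c <= RInt (fun s => M * Rpower (t - s) (- al - 1)) 0 c).
    { apply RInt_le; [lra | apply Hex; lra | |].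
      - apply (ex_RInt_scal (V := R_NormedModule)). apply ex_RInt_Rpower_sub; lra.
      - intros s Hs. unfold w. rewrite Rmult_comm.
        apply Rmult_le_compat_r; [apply Rlt_le, Rpower_gt0 | apply Hb2; lra]. }
    rewrite RInt_Rmult_l, RInt_Rpower_sub in HI by (try apply ex_RInt_Rpower_sub; lra).
    assert (H1 : Rpower (t - c) (- al) <= Rpower y0 (- al)) by (apply Rpower_le_neg; lra).
    pose proof (Rpower_gt0 (t - 0) (- al)).
    apply Rle_trans with (al * (M * ((Rpower (t - 0) (- al) - Rpower (t - c) (- al)) / - al))).
    - apply Rmult_le_compat_l; lra.
    - replace (al * (M * ((Rpower (t - 0) (- al) - Rpower (t - c) (- al)) / - al)))
        with (M * (Rpower (t - c) (- al) - Rpower (t - 0) (- al))) by (field; lra).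
      unfold sc. apply Rmult_le_compat_l; lra. }
  assert (Hr : 0 < al / (1 - al)) by (apply Rdiv_lt_0_compat; lra).
  assert (Hscr : 0 < sc * (al / (1 - al))) by (apply Rmult_lt_0_compat; lra).
  rewrite Rmult_plus_distr_l, Rmult_1_r.
  destruct (Rle_lt_dec (t - y0) 0) as [H1|H1].
  { pose proof (Hnear 0 ltac:(lra) ltac:(lra)). lra. }
  destruct (Rle_lt_dec a (t - y0)) as [H2|H2].
  { pose proof (Hfar a ltac:(lra) ltac:(lra)). lra. }
  rewrite <- (RInt_Chasles (V := R_CompleteNormedModule) w 0 (t - y0) a) by (apply Hex; lra).
  pose proof (Hnear (t - y0) ltac:(lra) ltac:(lra)).
  pose proof (Hfar (t - y0) ltac:(lra) ltac:(lra)).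
  unfold plus; simpl. lra.
Qed.

(* Maximising [V (y s) + k s] instead of [V (y s)] yields a time [t] at which
   the whole history obeys [V (y s) - V (y t) <= min (k (t - s)) M]. *)
Lemma lyapunov_decay d al (V : vec d -> R) (y G : R -> vec d) t1 y0 M m del :
  0 < al < 1 -> convex V -> differentiable V -> vcontinuity y -> vcontinuity G ->
  0 < y0 <= t1 -> 0 < M -> 0 < m -> 0 < del ->
  (forall s i, 0 <= s <= t1 -> y s i = y 0 i + frac al (fun u => G u i) s) ->
  (forall s, 0 <= V (y s) <= M) ->
  (forall t p, 0 <= t <= t1 -> m <= V (y t) -> has_gradient V (y t) p -> dot p (G t) <= - del) ->
  M * Rpower y0 (- al) * (al / (1 - al) + 2) < del / al ->
  V (y t1) < m.
Proof.
  intros Hal HV HVd Hy HG Hy0 HM Hm Hdel Heq Hbd Hneg Hsm.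
  destruct (Rlt_le_dec (V (y t1)) m) as [H|H]; [exact H|exfalso].
  (* Over [[0,t1]], of length at least [y0], this tilt gains at least [M], which keeps the maximum
     away from time zero. The caps [k (t - s)] and [M] meet exactly at distance [y0]. *)
  set (k := M / y0). assert (Hk : 0 < k) by (apply Rdiv_lt_0_compat; lra).
  assert (HVy : continuity (fun s => V (y s))) by (apply continuity_differentiable; assumption).
  destruct (continuity_ab_maj (fun s => V (y s) + k * s) 0 t1 ltac:(lra)) as [t [Hmax Ht]].
  { intros c _. apply (continuity_plus (fun s => V (y s)) (fun s => k * s)); [exact HVy|].
    apply (continuity_scal (fun s => s) k), derivable_continuous, derivable_id. }
  assert (H1 := Hmax t1 ltac:(lra)). simpl in H1.
  assert (Hkt : M <= k * t1).
  { unfold k. replace M with (M / y0 * y0) at 1 by (field; lra).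
    apply Rmult_le_compat_l; [apply Rlt_le, Rdiv_lt_0_compat|]; lra. }
  assert (Htpos : 0 < t).
  { destruct (Req_dec t 0) as [E|E]; [|lra].
    subst t. rewrite Rmult_0_r, Rplus_0_r in H1. pose proof (Hbd 0). lra. }
  assert (Hvt : m <= V (y t)) by nra.
  destruct (HVd (y t)) as [p Hp].
  assert (Hom1 : forall s, 0 <= s <= t -> V (y s) - V (y t) <= M / y0 * (t - s)).
  { intros s Hs. pose proof (Hmax s ltac:(lra)) as H2. simpl in H2. fold k. lra. }
  assert (Hom2 : forall s, 0 <= s <= t -> V (y s) - V (y t) <= M).
  { intros s Hs. pose proof (Hbd s). pose proof (Hbd t). lra. }
  assert (HF : Rpower t (- al) * (V (y t) - V (y 0)) + del / al
     <= M * Rpower y0 (- al) * (al / (1 - al) + 1)).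
  { apply (lyapunov_fermat d al V y G p); try assumption; try lra.
    - intros s i Hs. apply Heq. lra.
    - apply Hneg; try assumption.
    - intros a Ha. apply marchaud_capped; try assumption; try lra.
      apply (continuity_minus (fun s => V (y s)) (fun _ => V (y t))); [exact HVy|].
      apply continuity_const; intros ? ?; reflexivity. }
  (* At a tilted maximum [V (y t)] may lie below [V (y 0)], so the boundary term may be negative.
     The same two caps at [s = 0] bound its size by one more [M y0^(-al)], whence the [2] in the
     hypothesis against the [1] of [marchaud_capped]. *)
  assert (HT : Rpower t (- al) * (V (y 0) - V (y t)) <= M * Rpower y0 (- al)).
  { pose proof (Rpower_gt0 t (- al)) as HP.
    destruct (Rle_lt_dec t y0) as [Hty|Hty].
    - apply Rle_trans with (Rpower t (- al) * (M / y0 * (t - 0))).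
      { apply Rmult_le_compat_l; [lra|]. apply Hom1; lra. }
      replace (Rpower t (- al) * (M / y0 * (t - 0)))
        with (M / y0 * (Rpower t (- al) * t)) by ring.
      replace (M * Rpower y0 (- al)) with (M / y0 * (Rpower y0 (- al) * y0)) by (field; lra).
      apply Rmult_le_compat_l; [apply Rlt_le, Rdiv_lt_0_compat; lra|].
      replace (- al) with (1 - al - 1) by ring. rewrite <- !Rpower_pred by lra.
      apply Rle_Rpower_l; lra.
    - assert (Rpower t (- al) <= Rpower y0 (- al)) by (apply Rpower_le_neg; lra).
      apply Rle_trans with (Rpower t (- al) * M).
      + apply Rmult_le_compat_l; [lra|]. apply Hom2; lra.
      + rewrite Rmult_comm. apply Rmult_le_compat_l; lra. }
  lra.
Qed.

(** * Global existence for Lipschitz Volterra equations *)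

Lemma continuity_exp_scal lam : continuity (fun s => exp (lam * s)).
Proof. intros t. apply ex_derive_continuity_pt. auto_derive; exact I. Qed.

(** On the last stretch of length [eta] the exponential is at most its end value and the kernel has
    mass [eta^al / al]; before it the kernel is at most [eta^(al-1)] and the exponential integrates
    to at most [exp (lam t) / lam]. *)
Lemma frac_exp_le al lam eta t : 0 < al < 1 -> 0 < lam -> 0 < eta ->
  frac al (fun s => exp (lam * s)) t
  <= (rpow eta al / al + Rpower eta (al - 1) / lam) * exp (lam * t).
Proof.
  intros Hal Hlam Heta.
  pose proof (exp_pos (lam * t)) as He.
  assert (H1 : 0 <= rpow eta al / al) by (apply Rdiv_le_0_compat; [apply rpow_ge0 | lra]).
  assert (H2 : 0 < Rpower eta (al - 1) / lam)
    by (apply Rdiv_lt_0_compat; [apply Rpower_gt0 | exact Hlam]).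
  assert (Hinc : forall s, s <= t -> exp (lam * s) <= exp (lam * t)).
  { intros s [Hs|Hs]; [|subst; lra]. left. apply exp_increasing, Rmult_lt_compat_l; assumption. }
  destruct (Rle_lt_dec t eta) as [Ht|Ht].
  - apply Rle_trans with (frac al (fun _ => exp (lam * t)) t).
    + apply frac_le; [lra | apply continuity_exp_scal | |].
      * apply continuity_const; intros ? ?; reflexivity.
      * intros s Hs. apply Hinc; lra.
    + rewrite frac_const. apply Rmult_le_compat_r; [lra|].
      assert (rpow t al / al <= rpow eta al / al); [|lra].
      apply Rmult_le_compat_r; [apply Rlt_le, Rinv_0_lt_compat; lra | apply rpow_le; lra].
  - pose proof (frac_tail_bounds al (fun s => exp (lam * s)) t (t - eta) 0 (exp (lam * t))
      ltac:(lra) (continuity_exp_scal lam) ltac:(lra)) as Htl.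
    destruct Htl as [_ Htl].
    { intros u Hu. split; [apply Rlt_le, exp_pos | apply Hinc; lra]. }
    replace (t - (t - eta)) with eta in Htl by ring.
    assert (HI : RInt (fun u => Rpower (t - u) (al - 1) * exp (lam * u)) 0 (t - eta)
       <= RInt (fun u => Rpower eta (al - 1) * exp (lam * u)) 0 (t - eta)).
    { apply RInt_le; [lra | | |].
      - eexists. apply (is_RInt_frac_truncated al (fun s => exp (lam * s)));
          [lra | apply continuity_exp_scal | lra].
      - apply ex_RInt_continuity.
        apply (continuity_scal (fun u => exp (lam * u))), continuity_exp_scal.
      - intros u Hu. apply Rmult_le_compat_r; [apply Rlt_le, exp_pos|].
        apply Rpower_le_neg; lra. }
    rewrite RInt_Rmult_l in HI by (apply ex_RInt_continuity, continuity_exp_scal).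
    assert (HE : RInt (fun u => exp (lam * u)) 0 (t - eta) <= exp (lam * t) / lam).
    { assert (HR : is_RInt (fun u => exp (lam * u)) 0 (t - eta)
          (minus (/ lam * exp (lam * (t - eta))) (/ lam * exp (lam * 0)))).
      { apply (is_RInt_derive (V := R_CompleteNormedModule) (fun u => / lam * exp (lam * u))).
        - intros x _. auto_derive; [exact I|]. field. lra.
        - intros x _. apply continuity_continuous, continuity_exp_scal. }
      rewrite (is_RInt_unique _ _ _ _ HR). unfold minus, plus, opp; simpl.
      rewrite Rmult_0_r, exp_0.
      assert (0 < / lam) by (apply Rinv_0_lt_compat, Hlam).
      assert (/ lam * exp (lam * (t - eta)) <= / lam * exp (lam * t))
        by (apply Rmult_le_compat_l; [|apply Hinc]; lra).
      unfold Rdiv. lra. }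
    assert (Rpower eta (al - 1) * RInt (fun u => exp (lam * u)) 0 (t - eta)
            <= Rpower eta (al - 1) * (exp (lam * t) / lam))
      by (apply Rmult_le_compat_l; [apply Rlt_le, Rpower_gt0 | exact HE]).
    replace ((rpow eta al / al + Rpower eta (al - 1) / lam) * exp (lam * t))
      with (rpow eta al / al * exp (lam * t) + Rpower eta (al - 1) * (exp (lam * t) / lam))
      by (field; lra).
    lra.
Qed.

(** First [eta] is taken so small that the singular part costs at most a quarter; then
    [lam = 4 K eta^(al-1)] makes the rest exactly a quarter. The factor one half does not depend on
    [t]. *)
Lemma frac_exp_contraction al K : 0 < al < 1 -> 0 < K ->
  exists lam, 0 < lam /\
    forall t, K * frac al (fun s => exp (lam * s)) t <= / 2 * exp (lam * t).
Proof.
  intros Hal HK.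
  destruct (rpow_small al (al / K / 4) ltac:(lra)) as [d [Hd Hsm]].
  { repeat apply Rdiv_lt_0_compat; lra. }
  set (eta := d / 2). assert (Heta : 0 < eta) by (unfold eta; lra).
  specialize (Hsm eta ltac:(unfold eta; lra)).
  pose proof (Rpower_gt0 eta (al - 1)) as HP.
  exists (4 * K * Rpower eta (al - 1)).
  assert (Hlam : 0 < 4 * K * Rpower eta (al - 1)) by (apply Rmult_lt_0_compat; lra).
  split; [exact Hlam|]. intros t.
  set (lam := 4 * K * Rpower eta (al - 1)) in *.
  apply Rle_trans with (K * ((rpow eta al / al + Rpower eta (al - 1) / lam) * exp (lam * t))).
  { apply Rmult_le_compat_l; [lra|]. apply frac_exp_le; assumption. }
  rewrite <- Rmult_assoc. apply Rmult_le_compat_r; [apply Rlt_le, exp_pos|].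
  rewrite Rmult_plus_distr_l.
  assert (E1 : K * (Rpower eta (al - 1) / lam) = / 4) by (unfold lam; field; lra).
  assert (E2 : K * (rpow eta al / al) <= / 4).
  { replace (/ 4) with (K * ((al / K / 4) / al)) by (field; lra).
    apply Rmult_le_compat_l; [lra|]. apply Rmult_le_compat_r; [|lra].
    apply Rlt_le, Rinv_0_lt_compat; lra. }
  lra.
Qed.

(** The bands of half-width [2 c (/ 2)^n] around [u n] are nested, so their ends form adjacent
    sequences; this delivers the error bound together with the limit. *)
Lemma geometric_limit (u : nat -> R) c : 0 <= c ->
  (forall n, Rabs (u (S n) - u n) <= c * (/ 2) ^ n) ->
  exists l, forall n, Rabs (u n - l) <= 2 * c * (/ 2) ^ n.
Proof.
  intros Hc H.
  set (lo := fun n => u n - 2 * c * (/ 2) ^ n).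
  set (hi := fun n => u n + 2 * c * (/ 2) ^ n).
  assert (Hlo : forall n, lo n <= lo (S n)).
  { intros n. unfold lo. simpl. specialize (H n). apply Rabs_le_between in H. lra. }
  assert (Hhi : forall n, hi (S n) <= hi n).
  { intros n. unfold hi. simpl. specialize (H n). apply Rabs_le_between in H. lra. }
  assert (Hpow : forall n, 0 < (/ 2) ^ n) by (intros n; apply pow_lt; lra).
  assert (Hd : is_lim_seq (fun n => hi n - lo n) 0).
  { apply (is_lim_seq_ext (fun n => 4 * c * (/ 2) ^ n)).
    - intros n. unfold hi, lo. ring.
    - replace (Finite 0) with (Rbar_mult (4 * c) 0) by (simpl; f_equal; ring).
      apply is_lim_seq_scal_l, is_lim_seq_geom. rewrite Rabs_pos_eq; lra. }
  destruct (ex_lim_seq_adj lo hi Hlo Hhi Hd) as [[l1 H1] [[l2 H2] H3]].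
  apply is_lim_seq_unique in H1 as E1. apply is_lim_seq_unique in H2 as E2.
  rewrite E1, E2 in H3. injection H3 as H3. subst l2.
  exists l1. intros n.
  pose proof (is_lim_seq_incr_compare lo l1 H1 Hlo n).
  pose proof (is_lim_seq_decr_compare hi l1 H2 Hhi n).
  unfold lo, hi in *. apply Rabs_le. lra.
Qed.

Lemma half_pow_small c eps : 0 <= c -> 0 < eps -> exists n, c * (/ 2) ^ n < eps.
Proof.
  intros Hc He.
  destruct (pow_lt_1_zero (/ 2) ltac:(rewrite Rabs_pos_eq; lra) (eps / (c + 1))) as [n Hn].
  { apply Rdiv_lt_0_compat; lra. }
  exists n. specialize (Hn n (Nat.le_refl n)).
  assert (Hp : 0 < (/ 2) ^ n) by (apply pow_lt; lra).
  rewrite Rabs_pos_eq in Hn by lra.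
  apply Rle_lt_trans with ((c + 1) * (/ 2) ^ n); [apply Rmult_le_compat_r; lra|].
  replace eps with ((c + 1) * (eps / (c + 1))) by (field; lra).
  apply Rmult_lt_compat_l; lra.
Qed.

Lemma continuity_uniform_limit (u : nat -> R -> R) (l : R -> R) (c : R -> R) :
  (forall n, continuity (u n)) -> (forall t, 0 <= c t) ->
  (forall s t, s <= t -> c s <= c t) ->
  (forall n t, Rabs (u n t - l t) <= c t * (/ 2) ^ n) -> continuity l.
Proof.
  intros Hu Hc0 Hc H t eps Heps.
  destruct (half_pow_small (c (t + 1)) (eps / 3) (Hc0 _) ltac:(lra)) as [n Hn].
  destruct (Hu n t (eps / 3) ltac:(lra)) as [del [Hdel Hd]].
  exists (Rmin del 1). split; [apply Rmin_glb_lt; lra|].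
  intros s [Hs1 Hs]. simpl in *. unfold Rdist in *.
  assert (Hsd : Rabs (s - t) < del) by (eapply Rlt_le_trans; [exact Hs | apply Rmin_l]).
  assert (Hs2 : Rabs (s - t) < 1) by (eapply Rlt_le_trans; [exact Hs | apply Rmin_r]).
  apply Rabs_lt_between in Hs2.
  assert (Hb : forall r, r <= t + 1 -> Rabs (u n r - l r) < eps / 3).
  { intros r Hr. eapply Rle_lt_trans; [apply H|]. eapply Rle_lt_trans; [|exact Hn].
    apply Rmult_le_compat_r; [apply pow_le; lra | apply Hc, Hr]. }
  pose proof (Hb s ltac:(lra)) as B1. pose proof (Hb t ltac:(lra)) as B2.
  specialize (Hd s (conj Hs1 Hsd)).
  apply Rabs_lt_between in B1. apply Rabs_lt_between in B2. apply Rabs_lt_between in Hd.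
  apply Rabs_def1; lra.
Qed.

(** A mixed form: a component on the left, to feed the scalar estimate [frac_abs_le], and the
    Euclidean norm on the right, as in the hypothesis on [f]. *)
Definition vlipschitz {d} (L : R) (F : vec d -> vec d) : Prop :=
  forall x z i, Rabs (F x i - F z i) <= L * norm (vsub x z).

Lemma vcontinuity_vlipschitz d L (F : vec d -> vec d) y :
  0 <= L -> vlipschitz L F -> vcontinuity y -> vcontinuity (fun t => F (y t)).
Proof.
  intros HL HF Hy i t eps Heps.
  destruct (vcontinuity_norm d y t (eps / (L + 1)) Hy) as [del [Hdel Hd]].
  { apply Rdiv_lt_0_compat; lra. }
  exists del. split; [exact Hdel|]. intros s [_ Hs]. simpl in *. unfold Rdist in *.
  specialize (Hd s Hs). eapply Rle_lt_trans; [apply HF|].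
  pose proof (norm_ge0 d (vsub (y s) (y t))).
  apply Rle_lt_trans with ((L + 1) * norm (vsub (y s) (y t))); [apply Rmult_le_compat_r; lra|].
  replace eps with ((L + 1) * (eps / (L + 1))) by (field; lra).
  apply Rmult_lt_compat_l; lra.
Qed.

Lemma frac_minus al g1 g2 t : 0 < al -> continuity g1 -> continuity g2 ->
  frac al (fun s => g1 s - g2 s) t = frac al g1 t - frac al g2 t.
Proof.
  intros Hal H1 H2.
  rewrite (frac_ext al (fun s => g1 s - g2 s) (fun s => g1 s + -1 * g2 s))
    by (try exact Hal; intros; ring).
  rewrite frac_plus, frac_scal by (try assumption; apply (continuity_scal g2 (-1)), H2).
  ring.
Qed.

Fixpoint picard {d} (al : R) (F : vec d -> vec d) (x0 : vec d) (n : nat) : R -> vec d :=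
  match n with
  | O => fun _ => x0
  | S n => fun t i => x0 i + frac al (fun s => F (picard al F x0 n s) i) t
  end.

Lemma vcontinuity_picard d al L (F : vec d -> vec d) (x0 : vec d) n :
  0 < al -> 0 <= L -> vlipschitz L F -> vcontinuity (picard al F x0 n).
Proof.
  intros Hal HL HF. induction n as [|n IH]; intros i; simpl.
  - apply continuity_const; intros ? ?; reflexivity.
  - apply (continuity_plus (fun _ => x0 i)); [apply continuity_const; intros ? ?; reflexivity|].
    apply continuity_frac; [exact Hal|].
    apply (vcontinuity_vlipschitz d L F _ HL HF IH i).
Qed.

(** The factor [INR d] is the price of returning from component bounds to the norm; the [+ 1] keeps
    the contraction constant positive when [L] or [d] is zero. *)
Lemma frac_vlipschitz_le d al L lam (F : vec d -> vec d) (y z : R -> vec d) c t i :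
  0 < al -> 0 <= L -> 0 <= c -> vlipschitz L F -> vcontinuity y -> vcontinuity z ->
  (forall t, (L * INR d + 1) * frac al (fun s => exp (lam * s)) t <= / 2 * exp (lam * t)) ->
  (forall s j, Rabs (y s j - z s j) <= c * exp (lam * s)) ->
  Rabs (frac al (fun s => F (y s) i) t - frac al (fun s => F (z s) i) t)
  <= c * / 2 * exp (lam * t).
Proof.
  intros Hal HL Hc HF Hy Hz Hlam H.
  pose proof (vcontinuity_vlipschitz d L F y HL HF Hy i) as HFy.
  pose proof (vcontinuity_vlipschitz d L F z HL HF Hz i) as HFz.
  rewrite <- frac_minus by assumption.
  pose proof (continuity_exp_scal lam) as Hexp.
  apply Rle_trans with (frac al (fun s => c * (L * INR d + 1) * exp (lam * s)) t).
  - apply frac_abs_le; [exact Hal | | |].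
    + apply (continuity_minus (fun s => F (y s) i) (fun s => F (z s) i)); assumption.
    + apply (continuity_scal (fun s => exp (lam * s))), Hexp.
    + intros s _. eapply Rle_trans; [apply HF|].
      pose proof (norm_le_dim d (vsub (y s) (z s)) (c * exp (lam * s)) (fun j => H s j)) as Hn.
      assert (H1 : L * norm (vsub (y s) (z s)) <= L * (INR d * (c * exp (lam * s))))
        by (apply Rmult_le_compat_l; assumption).
      assert (H2 : 0 <= c * exp (lam * s)) by (apply Rmult_le_pos; [exact Hc | apply Rlt_le, exp_pos]).
      lra.
  - rewrite frac_scal by assumption.
    rewrite !Rmult_assoc. apply Rmult_le_compat_l; [exact Hc | apply Hlam].
Qed.

Lemma volterra_solution_exists d al L (F : vec d -> vec d) (x0 : vec d) :
  0 < al < 1 -> 0 <= L -> vlipschitz L F ->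
  exists x : R -> vec d, vcontinuity x /\
    forall t i, x t i = x0 i + frac al (fun s => F (x s) i) t.
Proof.
  intros Hal HL HF.
  destruct (frac_exp_contraction al (L * INR d + 1) Hal) as [lam [Hlam Hcon]].
  { pose proof (Rmult_le_pos _ _ HL (pos_INR d)). lra. }
  set (u := picard al F x0).
  assert (Hu : forall n, vcontinuity (u n)).
  { intros n. apply (vcontinuity_picard d al L); tauto || lra. }
  pose proof (continuity_exp_scal lam) as Hexp.
  set (C := norm (F x0)). assert (HC : 0 <= C) by apply norm_ge0.
  assert (Hstep : forall n t i, Rabs (u (S n) t i - u n t i) <= C * exp (lam * t) * (/ 2) ^ n).
  { induction n as [|n IH]; intros t i.
    - replace (u 1%nat t i - u 0%nat t i) with (frac al (fun _ => F x0 i) t)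
        by (unfold u; simpl; ring).
      simpl. rewrite Rmult_1_r.
      apply Rle_trans with (frac al (fun s => C * exp (lam * s)) t).
      + apply frac_abs_le; [lra | | |].
        * apply continuity_const; intros ? ?; reflexivity.
        * apply (continuity_scal (fun s => exp (lam * s))), Hexp.
        * intros s Hs. apply Rle_trans with C; [apply abs_le_norm|].
          rewrite <- (Rmult_1_r C) at 1. apply Rmult_le_compat_l; [exact HC|].
          pose proof (exp_ineq1_le (lam * s)).
          assert (0 <= lam * s) by (apply Rmult_le_pos; lra). lra.
      + rewrite frac_scal by (try exact Hexp; lra). apply Rmult_le_compat_l; [exact HC|].
        assert (H0 : 0 <= frac al (fun s => exp (lam * s)) t).
        { replace 0 with (frac al (fun _ => 0) t) by (rewrite frac_const; ring).
          apply frac_le; [lra | | exact Hexp |].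
          - apply continuity_const; intros ? ?; reflexivity.
          - intros s _. apply Rlt_le, exp_pos. }
        pose proof (Hcon t). pose proof (exp_pos (lam * t)).
        assert (0 <= L * INR d * frac al (fun s => exp (lam * s)) t).
        { apply Rmult_le_pos; [apply Rmult_le_pos; [exact HL | apply pos_INR] | exact H0]. }
        lra.
    - change (u (S (S n)) t i) with (x0 i + frac al (fun s => F (u (S n) s) i) t).
      change (u (S n) t i) with (x0 i + frac al (fun s => F (u n s) i) t).
      replace (x0 i + frac al (fun s => F (u (S n) s) i) t - (x0 i + frac al (fun s => F (u n s) i) t))
        with (frac al (fun s => F (u (S n) s) i) t - frac al (fun s => F (u n s) i) t) by ring.
      replace (C * exp (lam * t) * (/ 2) ^ S n)
        with (C * (/ 2) ^ n * / 2 * exp (lam * t)) by (simpl; ring).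
      apply (frac_vlipschitz_le d al L lam F); try assumption; try lra; try apply Hu.
      + apply Rmult_le_pos; [exact HC | apply pow_le; lra].
      + intros s j. eapply Rle_trans; [apply IH|]. right. ring. }
  set (P := fun t i l => forall n, Rabs (u n t i - l) <= 2 * C * exp (lam * t) * (/ 2) ^ n).
  assert (Hex : forall t i, exists l, P t i l).
  { intros t i. destruct (geometric_limit (fun n => u n t i) (C * exp (lam * t))) as [l Hl].
    - apply Rmult_le_pos; [exact HC | apply Rlt_le, exp_pos].
    - intros n. apply Hstep.
    - exists l. intros n. eapply Rle_trans; [apply Hl|]. right. ring. }
  set (x := fun t i => epsilon (inhabits 0) (P t i)).
  assert (Hx : forall t i, P t i (x t i)) by (intros t i; apply epsilon_spec, Hex).
  assert (Hxc : vcontinuity x).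
  { intros i. apply (continuity_uniform_limit (fun n t => u n t i) _ (fun t => 2 * C * exp (lam * t))).
    - intros n. apply Hu.
    - intros t. apply Rmult_le_pos; [lra | apply Rlt_le, exp_pos].
    - intros s t [Hst|Hst]; [|subst; lra]. apply Rmult_le_compat_l; [lra|].
      left. apply exp_increasing, Rmult_lt_compat_l; assumption.
    - intros n t. apply Hx. }
  exists x. split; [exact Hxc|]. intros t i.
  (* [u (S n) t] is near [x t] by the error bound, and near the right-hand side because the integral
     operator halves the weighted distance from [u n] to [x]. *)
  apply cond_eq. intros eps Heps.
  destruct (half_pow_small (2 * C * exp (lam * t)) (eps / 2)) as [n Hn].
  { apply Rmult_le_pos; [lra | apply Rlt_le, exp_pos]. }
  { lra. }
  pose proof (Hx t i (S n)) as B1.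
  assert (B2 : Rabs (frac al (fun s => F (u n s) i) t - frac al (fun s => F (x s) i) t)
     <= 2 * C * (/ 2) ^ n * / 2 * exp (lam * t)).
  { apply (frac_vlipschitz_le d al L lam F); try assumption; try lra; try apply Hu.
    - apply Rmult_le_pos; [lra | apply pow_le; lra].
    - intros s j. eapply Rle_trans; [apply Hx|]. right. ring. }
  change (u (S n) t i) with (x0 i + frac al (fun s => F (u n s) i) t) in B1.
  simpl in B1. apply Rabs_le_between in B1. apply Rabs_le_between in B2.
  assert (0 <= 2 * C * exp (lam * t) * (/ 2) ^ n).
  { apply Rmult_le_pos; [apply Rmult_le_pos; [lra | apply Rlt_le, exp_pos] | apply pow_le; lra]. }
  apply Rabs_def1; lra.
Qed.

(** * Solutions of the fractional system *)

Lemma norm_le_components d (x z : vec d) :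
  (forall i, Rabs (x i) <= Rabs (z i)) -> norm x <= norm z.
Proof.
  intros H. apply sqrt_le_1_alt, fsum_le. intros i. apply Rsqr_le_abs_1, H.
Qed.

Definition clamp (lo hi x : R) : R := Rmax lo (Rmin hi x).

Lemma clamp_id lo hi x : lo <= x <= hi -> clamp lo hi x = x.
Proof. intros H. unfold clamp. rewrite Rmin_right, Rmax_right; lra. Qed.

Lemma clamp_range lo hi x : lo <= hi -> lo <= clamp lo hi x <= hi.
Proof.
  intros H. split; [apply Rmax_l|]. apply Rmax_lub; [exact H | apply Rmin_l].
Qed.

Lemma clamp_lipschitz lo hi x z : Rabs (clamp lo hi x - clamp lo hi z) <= Rabs (x - z).
Proof.
  unfold clamp, Rmax, Rmin.
  destruct (Rle_dec hi x), (Rle_dec hi z);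
    repeat match goal with |- context [Rle_dec ?a ?b] => destruct (Rle_dec a b) end;
    unfold Rabs; repeat destruct Rcase_abs; lra.
Qed.

(** Projection onto a cube rather than a ball: it acts coordinatewise, so it is visibly nonexpansive
    for the Euclidean norm. With half-side [rho / (INR d + 1)] the cube lies in the ball of radius
    [rho] where [f] is Lipschitz. *)
Definition vclamp {d} (q : R) (x : vec d) : vec d := fun i => clamp (- q) q (x i).

Lemma vclamp_id d q (x : vec d) : norm x <= q -> vclamp q x = x.
Proof.
  intros H. apply functional_extensionality. intros i. apply clamp_id.
  apply Rabs_le_between. eapply Rle_trans; [apply abs_le_norm | exact H].
Qed.

Lemma norm_vclamp_le d rho (x : vec d) : 0 < rho ->
  norm (vclamp (rho / (INR d + 1)) x) <= rho.
Proof.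
  intros Hrho. pose proof (pos_INR d) as Hd.
  assert (Hq : 0 < rho / (INR d + 1)) by (apply Rdiv_lt_0_compat; lra).
  eapply Rle_trans; [apply (norm_le_dim d _ (rho / (INR d + 1)))|].
  - intros i. unfold vclamp. apply Rabs_le, clamp_range. lra.
  - apply Rle_trans with ((INR d + 1) * (rho / (INR d + 1))).
    + apply Rmult_le_compat_r; lra.
    + right. field. lra.
Qed.

(** Used with [gam = Gamma al], the division absorbs the normalisation that [frac] lacks. *)
Definition cutoff_field {d} (q gam : R) (f : vec d -> vec d) (x : vec d) : vec d :=
  fun i => f (vclamp q x) i / gam.

Lemma vlipschitz_cutoff_field d rho L gam (f : vec d -> vec d) :
  0 < rho -> 0 <= L -> 0 < gam ->
  (forall x y, norm x <= rho -> norm y <= rho ->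
     norm (vsub (f x) (f y)) <= L * norm (vsub x y)) ->
  vlipschitz (L / gam) (cutoff_field (rho / (INR d + 1)) gam f).
Proof.
  intros Hrho HL Hgam Hf x z i. unfold cutoff_field.
  set (q := rho / (INR d + 1)).
  replace (f (vclamp q x) i / gam - f (vclamp q z) i / gam)
    with (vsub (f (vclamp q x)) (f (vclamp q z)) i * / gam) by (unfold vsub; field; lra).
  rewrite Rabs_mult, (Rabs_pos_eq (/ gam)) by (apply Rlt_le, Rinv_0_lt_compat, Hgam).
  replace (L / gam * norm (vsub x z)) with (L * norm (vsub x z) * / gam) by (field; lra).
  apply Rmult_le_compat_r; [apply Rlt_le, Rinv_0_lt_compat, Hgam|].
  eapply Rle_trans; [apply abs_le_norm|].
  eapply Rle_trans; [apply Hf; apply norm_vclamp_le, Hrho|].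
  apply Rmult_le_compat_l; [exact HL|].
  apply norm_le_components. intros j. apply clamp_lipschitz.
Qed.

(** [tau] is the supremum of the times up to which [n] stays at most [e]. The bound on all of
    [[0,tau]], end point included, lets the Lyapunov estimate apply at the hitting time itself. *)
Lemma first_hit (n : R -> R) e t : continuity n -> n 0 < e -> 0 <= t -> e <= n t ->
  exists tau, 0 < tau <= t /\ n tau = e /\ forall s, 0 <= s <= tau -> n s <= e.
Proof.
  intros Hn H0 Ht Het.
  set (E := fun s => 0 <= s <= t /\ forall u, 0 <= u <= s -> n u <= e).
  destruct (completeness E) as [tau [Hub Hlub]].
  { exists t. intros s [Hs _]. lra. }
  { exists 0. split; [lra|]. intros u Hu. replace u with 0 by lra. lra. }
  assert (Htau0 : 0 <= tau).
  { apply Hub. split; [lra|]. intros u Hu. replace u with 0 by lra. lra. }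
  assert (Htaut : tau <= t) by (apply Hlub; intros s [Hs _]; lra).
  assert (Hbelow : forall u, 0 <= u < tau -> n u <= e).
  { intros u Hu. apply Rnot_lt_le. intros Hc.
    assert (tau <= u); [|lra]. apply Hlub. intros s [Hs Hse].
    apply Rnot_lt_le. intros Hus. specialize (Hse u ltac:(lra)). lra. }
  assert (Hle : n tau <= e).
  { apply Rnot_lt_le. intros Hc.
    assert (tau <> 0) by (intros E0; subst; lra).
    destruct (Hn tau (n tau - e) ltac:(lra)) as [del [Hdel Hd]].
    simpl in Hd. unfold Rdist in Hd.
    set (s := Rmax 0 (tau - del / 2)).
    assert (Hs0 : 0 <= s) by apply Rmax_l.
    assert (Hs1 : s < tau) by (apply Rmax_lub_lt; lra).
    assert (Hs2 : tau - del / 2 <= s) by apply Rmax_r.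
    assert (Hds : Rabs (n s - n tau) < n tau - e).
    { apply Hd. split; [split; [exact I | lra]|]. apply Rabs_def1; lra. }
    apply Rabs_lt_between in Hds. specialize (Hbelow s ltac:(lra)). lra. }
  assert (Hge : e <= n tau).
  { apply Rnot_lt_le. intros Hc.
    assert (Hne : tau <> t) by (intros E0; subst; lra).
    destruct (Hn tau (e - n tau) ltac:(lra)) as [del [Hdel Hd]].
    simpl in Hd. unfold Rdist in Hd.
    set (s := Rmin t (tau + del / 2)).
    assert (Hs1 : tau < s) by (apply Rmin_glb_lt; lra).
    assert (Hs2 : s <= t) by apply Rmin_l.
    assert (Hs3 : s <= tau + del / 2) by apply Rmin_r.
    assert (s <= tau); [|lra]. apply Hub. split; [lra|].
    intros u Hu. destruct (Rlt_le_dec u tau) as [Hut|Hut]; [apply Hbelow; lra|].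
    destruct (Req_dec tau u) as [Eu|Eu]; [subst; lra|].
    assert (Hdu : Rabs (n u - n tau) < e - n tau).
    { apply Hd. split; [split; [exact I | exact Eu]|]. apply Rabs_def1; lra. }
    apply Rabs_lt_between in Hdu. lra. }
  exists tau. repeat split; try lra.
  - destruct (Req_dec tau 0) as [E0|E0]; [subst; lra | lra].
  - intros s Hs. destruct (Req_dec s tau) as [Es|Es]; [subst; lra | apply Hbelow; lra].
Qed.

(** A barrier argument. The integral equation is granted only while [y] has stayed in the closed
    ball, since the cutoff may alter the field outside; the first hitting time of the sphere
    respects this restriction. There [V] would be at least [lev], yet at most [V (y 0)]. *)
Lemma lyapunov_ball_invariant d al L (V : vec d -> R) (F : vec d -> vec d) y e lev t1 :
  0 < al < 1 -> convex V -> differentiable V -> 0 <= L -> vlipschitz L F -> vcontinuity y ->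
  norm (y 0) < e -> V (y 0) < lev ->
  (forall z, norm z = e -> lev <= V z) ->
  (forall z p, norm z <= e -> has_gradient V z p -> dot p (F z) <= 0) ->
  (forall t2, 0 <= t2 <= t1 -> (forall s, 0 <= s <= t2 -> norm (y s) <= e) ->
     forall s i, 0 <= s <= t2 -> y s i = y 0 i + frac al (fun u => F (y u) i) s) ->
  forall t, 0 <= t <= t1 -> norm (y t) < e.
Proof.
  intros Hal HV HVd HL HF Hy H0 HV0 Hlev Hgrad Heq t Ht.
  apply Rnot_le_lt. intros Hc.
  destruct (first_hit (fun s => norm (y s)) e t (continuity_norm d y Hy) H0 ltac:(lra) Hc)
    as [tau [Htau [Hne Hle]]].
  assert (V (y tau) <= V (y 0)).
  { apply (lyapunov_nonincreasing d al V y (fun s => F (y s)) tau); try assumption; try lra.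
    - apply (vcontinuity_vlipschitz d L F y HL HF Hy).
    - apply (Heq tau ltac:(lra) Hle).
    - intros s p Hs. apply Hgrad, Hle, Hs. }
  specialize (Hlev (y tau) Hne). lra.
Qed.

Lemma solution_initial d al D f (x0 : vec d) T x : is_solution al D f x0 T x -> x 0 = x0.
Proof.
  intros [HT [_ [_ Heq]]]. apply functional_extensionality. intros i.
  destruct (Heq 0 ltac:(lra) i) as [[_ H]|[H _]]; lra.
Qed.

(** A solution is arbitrary outside [[0,T)]. Freezing it at [t1 < T] gives a curve continuous on the
    whole line, as the lemmas on [frac] demand, and leaves it unchanged on [[0,t1]]. *)
Lemma solution_clamp_vcontinuity d al D f (x0 : vec d) T x t1 :
  is_solution al D f x0 T x -> 0 <= t1 < T -> vcontinuity (fun s => x (clamp 0 t1 s)).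
Proof.
  intros [_ [Hc _]] Ht1 i t eps Heps.
  pose proof (clamp_range 0 t1 t ltac:(lra)).
  destruct (Hc (clamp 0 t1 t) ltac:(lra) eps Heps) as [del [Hdel Hd]].
  exists del. split; [exact Hdel|]. intros s [_ Hs]. simpl in *. unfold Rdist in *.
  pose proof (clamp_range 0 t1 s ltac:(lra)).
  eapply Rle_lt_trans; [|apply (Hd (clamp 0 t1 s))].
  - apply (abs_le_norm d (vsub (x (clamp 0 t1 s)) (x (clamp 0 t1 t)))).
  - lra.
  - eapply Rle_lt_trans; [apply clamp_lipschitz | exact Hs].
Qed.

Lemma sing_int_cutoff d al q L (f : vec d -> vec d) y i t :
  0 < al < 1 -> 0 < t -> 0 <= L -> vlipschitz L (cutoff_field q (Gamma al) f) ->
  vcontinuity y -> (forall s, 0 <= s < t -> norm (y s) <= q) ->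
  sing_int al (fun s => f (y s) i) t
    (Gamma al * frac al (fun s => cutoff_field q (Gamma al) f (y s) i) t).
Proof.
  intros Hal Ht HL HF Hy Hq. pose proof (Gamma_pos al Hal) as HG.
  pose proof (vcontinuity_vlipschitz d L _ y HL HF Hy i) as HFc.
  rewrite <- frac_scal by (try exact HFc; lra).
  apply (sing_int_ext al (fun s => Gamma al * cutoff_field q (Gamma al) f (y s) i)).
  - intros s Hs. unfold cutoff_field. rewrite vclamp_id by (apply Hq, Hs). field. lra.
  - apply sing_int_frac; [lra | | exact Ht].
    apply (continuity_scal (fun s => cutoff_field q (Gamma al) f (y s) i)), HFc.
Qed.

(** The integral in the definition of a solution and [frac] are both limits in [sing_int] for
    integrands that agree on [[0,s)], so uniqueness of the limit identifies them. *)
Lemma solution_clamp_equation d al D f (x0 : vec d) T x t1 t2 q L :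
  0 < al < 1 -> 0 <= L -> vlipschitz L (cutoff_field q (Gamma al) f) ->
  is_solution al D f x0 T x -> 0 <= t1 < T -> t2 <= t1 ->
  (forall s, 0 <= s <= t2 -> norm (x (clamp 0 t1 s)) <= q) ->
  forall s i, 0 <= s <= t2 ->
    x (clamp 0 t1 s) i
    = x (clamp 0 t1 0) i + frac al (fun u => cutoff_field q (Gamma al) f (x (clamp 0 t1 u)) i) s.
Proof.
  intros Hal HL HF Hsol Ht1 Ht2 Hq s i Hs.
  pose proof (solution_clamp_vcontinuity d al D f x0 T x t1 Hsol Ht1) as Hy.
  pose proof (solution_initial d al D f x0 T x Hsol) as Hx0.
  rewrite !(clamp_id 0 t1) by lra. rewrite Hx0.
  destruct Hsol as [_ [_ [_ Heq]]].
  pose proof (Gamma_pos al Hal) as HG.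
  destruct (Heq s ltac:(lra) i) as [[E0 E1]|[Hpos [w [Hw E1]]]].
  - rewrite E0 in *. rewrite frac_nonpos by lra. lra.
  - assert (Ew : w = Gamma al *
        frac al (fun u => cutoff_field q (Gamma al) f (x (clamp 0 t1 u)) i) s).
    { apply (sing_int_unique al (fun u => f (x (clamp 0 t1 u)) i) s); [exact Hpos | |].
      - apply (sing_int_ext al (fun u => f (x u) i)); [|exact Hw].
        intros u Hu. rewrite clamp_id by lra. reflexivity.
      - apply (sing_int_cutoff d al q L f (fun u => x (clamp 0 t1 u))); try assumption.
        intros u Hu. apply Hq. lra. }
    rewrite Ew in E1.
    replace (Gamma al * frac al (fun u => cutoff_field q (Gamma al) f (x (clamp 0 t1 u)) i) s / Gamma al)
      with (frac al (fun u => cutoff_field q (Gamma al) f (x (clamp 0 t1 u)) i) s) in E1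
      by (field; lra).
    lra.
Qed.

Lemma global_solution_of_volterra d al (D : vec d -> Prop) f (x0 : vec d) x q L :
  0 < al < 1 -> 0 <= L -> vlipschitz L (cutoff_field q (Gamma al) f) -> vcontinuity x ->
  (forall t i, x t i = x0 i + frac al (fun s => cutoff_field q (Gamma al) f (x s) i) t) ->
  (forall t, 0 <= t -> norm (x t) <= q) -> (forall t, 0 <= t -> D (x t)) ->
  is_global_solution al D f x0 x.
Proof.
  intros Hal HL HF Hx Heq Hq HD T HT. pose proof (Gamma_pos al Hal) as HG.
  split; [exact HT|]. split; [|split].
  - intros t Ht eps Heps. destruct (vcontinuity_norm d x t eps Hx Heps) as [del [Hdel Hd]].
    exists del. split; [exact Hdel|]. intros s _ Hs. apply Hd, Hs.
  - intros t Ht. apply HD. lra.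
  - intros t Ht i. destruct (Req_dec t 0) as [E|E].
    + left. split; [exact E|]. rewrite Heq, frac_nonpos by lra. ring.
    + right. split; [lra|].
      exists (Gamma al * frac al (fun s => cutoff_field q (Gamma al) f (x s) i) t). split.
      * apply (sing_int_cutoff d al q L f x i t); try assumption; try lra.
        intros s Hs. apply Hq. lra.
      * rewrite Heq. field. lra.
Qed.

Theorem theorem4 (d : nat) (alpha : R) (D : vec d -> Prop) (f : vec d -> vec d)
  (V : vec d -> R) (a b c C1 C2 C3 r : R) :
  0 < alpha < 1 ->
  is_open D -> D vzero ->
  f vzero = vzero ->
  loc_lipschitz_near0 D f ->
  (forall x, 0 <= V x) ->
  convex V -> differentiable V ->
  0 < a -> 0 < b -> 0 < C1 -> 0 < C2 -> 0 < r ->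
  (forall x : vec d, norm x <= r -> D x) ->
  (forall x : vec d, norm x <= r ->
      C1 * rpow (norm x) a <= V x /\ V x <= C2 * rpow (norm x) b) ->
  0 <= C3 -> b <= c ->
  (forall x g : vec d, norm x <= r -> has_gradient V x g ->
      dot g (f x) <= - C3 * rpow (norm x) c) ->
  (C3 = 0 -> stable alpha D f) /\
  (0 < C3 -> asymptotically_stable alpha D f).
Proof.
  intros Hal _ _ _ Hlip HVpos HVc HVd Ha Hb HC1 HC2 Hr HrD HVb HC3 Hbc Hgrad.
  destruct Hlip as [rho [L [Hrho [HL [_ Hf]]]]].
  pose proof (Gamma_pos alpha Hal) as HG.
  set (q := rho / (INR d + 1)).
  assert (Hq : 0 < q).
  { apply Rdiv_lt_0_compat; [exact Hrho|]. pose proof (pos_INR d). lra. }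
  set (F := cutoff_field q (Gamma alpha) f).
  set (L' := L / Gamma alpha).
  assert (HL' : 0 <= L') by (apply Rdiv_le_0_compat; assumption).
  assert (HF : vlipschitz L' F) by (apply vlipschitz_cutoff_field; assumption).
  assert (HdotF : forall p z, norm z <= q -> dot p (F z) = dot p (f z) / Gamma alpha).
  { intros p z Hz. unfold Rdiv. rewrite Rmult_comm, <- dot_vscal. unfold dot.
    apply fsum_ext. intros i. unfold F, cutoff_field, vscal. rewrite vclamp_id by exact Hz.
    field. lra. }
  (* Within radius [e0] the clamping is the identity and the assumptions on [V] are in force. *)
  set (e0 := Rmin q r).
  assert (He0 : 0 < e0) by (apply Rmin_glb_lt; assumption).
  assert (He0q : e0 <= q) by apply Rmin_l.
  assert (He0r : e0 <= r) by apply Rmin_r.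
  assert (HgradF : forall z p, norm z <= e0 -> has_gradient V z p ->
     dot p (F z) <= - (C3 / Gamma alpha * rpow (norm z) c)).
  { intros z p Hz Hp. rewrite HdotF by lra.
    pose proof (Hgrad z p ltac:(lra) Hp) as Hg.
    replace (- (C3 / Gamma alpha * rpow (norm z) c))
      with (- C3 * rpow (norm z) c * / Gamma alpha) by (field; lra).
    apply Rmult_le_compat_r; [apply Rlt_le, Rinv_0_lt_compat, HG | exact Hg]. }
  assert (HgradF0 : forall z p, norm z <= e0 -> has_gradient V z p -> dot p (F z) <= 0).
  { intros z p Hz Hp. eapply Rle_trans; [apply HgradF; eassumption|].
    assert (0 <= C3 / Gamma alpha * rpow (norm z) c); [|lra].
    apply Rmult_le_pos; [apply Rdiv_le_0_compat; assumption | apply rpow_ge0]. }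
  (* Stated for curves, to serve twice: for a given solution frozen in time, and for the Volterra
     solution, which is recognised as a solution of the system only once it is confined. *)
  assert (Hinv : forall e (y : R -> vec d) t1, 0 < e <= e0 -> vcontinuity y ->
     norm (y 0) < e -> V (y 0) < C1 * rpow e a ->
     (forall t2, 0 <= t2 <= t1 -> (forall s, 0 <= s <= t2 -> norm (y s) <= e) ->
        forall s i, 0 <= s <= t2 -> y s i = y 0 i + frac alpha (fun u => F (y u) i) s) ->
     forall t, 0 <= t <= t1 -> norm (y t) < e).
  { intros e y t1 He Hy H0 HV0 Heq.
    apply (lyapunov_ball_invariant d alpha L' V F y e (C1 * rpow e a) t1); try assumption.
    - intros z Hz. rewrite <- Hz. apply HVb. lra.
    - intros z p Hz. apply HgradF0. lra. }
  assert (Hsol_ball : forall e x0 T x, 0 < e <= e0 -> norm x0 < e -> V x0 < C1 * rpow e a ->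
     is_solution alpha D f x0 T x -> forall t, 0 <= t < T -> norm (x t) < e).
  { intros e x0 T x He Hx0 HVx0 Hsol t Ht.
    pose proof (solution_initial d alpha D f x0 T x Hsol) as Hinit.
    assert (Hc0 : clamp 0 t 0 = 0) by (apply clamp_id; lra).
    assert (Hct : clamp 0 t t = t) by (apply clamp_id; lra).
    rewrite <- Hct.
    apply (Hinv e (fun s => x (clamp 0 t s)) t); try assumption; try lra.
    - apply (solution_clamp_vcontinuity d alpha D f x0 T x t Hsol Ht).
    - rewrite Hc0, Hinit. exact Hx0.
    - rewrite Hc0, Hinit. exact HVx0.
    - intros t2 Ht2 Hn.
      apply (solution_clamp_equation d alpha D f x0 T x t t2 q L'); try assumption; try lra.
      intros s Hs. specialize (Hn s Hs). simpl in Hn. lra. }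
  assert (Hexist : forall e x0, 0 < e <= e0 -> norm x0 < e -> V x0 < C1 * rpow e a ->
     exists x, is_global_solution alpha D f x0 x).
  { intros e x0 He Hx0 HVx0.
    destruct (volterra_solution_exists d alpha L' F x0 Hal HL' HF) as [x [Hx Heq]].
    assert (Hx00 : x 0 = x0).
    { apply functional_extensionality. intros i. rewrite Heq, frac_nonpos by lra. ring. }
    assert (Hn : forall t, 0 <= t -> norm (x t) < e).
    { intros t Ht. apply (Hinv e x t); try rewrite Hx00; try assumption; try lra.
      intros t2 _ _ s i _. rewrite Heq. reflexivity. }
    exists x. apply (global_solution_of_volterra d alpha D f x0 x q L'); try assumption.
    - intros t Ht. specialize (Hn t Ht). lra.
    - intros t Ht. apply HrD. specialize (Hn t Ht). lra. }
  (* On the sphere of radius [e] the lower bound puts [V] at or above [C1 e^a]; the upper bound puts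
     [V x0] below that level once [norm x0] is small. *)
  assert (Hdel : forall e, 0 < e <= e0 -> exists del, 0 < del /\
     forall x0 : vec d, norm x0 < del -> norm x0 < e /\ V x0 < C1 * rpow e a).
  { intros e He.
    assert (Hlev : 0 < C1 * rpow e a).
    { apply Rmult_lt_0_compat; [exact HC1 | apply rpow_gt0; lra]. }
    destruct (rpow_small b (C1 * rpow e a / C2) Hb) as [del [Hdel Hsm]].
    { apply Rdiv_lt_0_compat; assumption. }
    exists (Rmin e del). split; [apply Rmin_glb_lt; lra|]. intros x0 Hx0.
    assert (H1 : norm x0 < e) by (eapply Rlt_le_trans; [exact Hx0 | apply Rmin_l]).
    assert (H2 : norm x0 < del) by (eapply Rlt_le_trans; [exact Hx0 | apply Rmin_r]).
    split; [exact H1|]. specialize (Hsm _ H2).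
    eapply Rle_lt_trans; [apply HVb; lra|].
    replace (C1 * rpow e a) with (C2 * (C1 * rpow e a / C2)) by (field; lra).
    apply Rmult_lt_compat_l; assumption. }
  assert (Hstable : stable alpha D f).
  { intros eps Heps.
    destruct (Hdel (Rmin e0 eps)) as [del [Hdelpos Hd]].
    { split; [apply Rmin_glb_lt; assumption | apply Rmin_l]. }
    assert (He : 0 < Rmin e0 eps <= e0)
      by (split; [apply Rmin_glb_lt; assumption | apply Rmin_l]).
    exists del. split; [exact Hdelpos|]. intros x0 Hx0. destruct (Hd x0 Hx0) as [H1 H2]. split.
    - apply (Hexist _ x0 He H1 H2).
    - intros T x Hsol t Ht.
      eapply Rlt_le_trans; [apply (Hsol_ball _ x0 T x He H1 H2 Hsol t Ht) | apply Rmin_r]. }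
  split; [intros _; exact Hstable|]. intros HC3pos. split; [exact Hstable|].
  destruct (Hdel e0 ltac:(lra)) as [dhat [Hdhat Hd]].
  exists dhat. split; [exact Hdhat|]. intros x0 Hx0. destruct (Hd x0 Hx0) as [Hn0 HV0].
  split; [apply (Hexist e0 x0); try assumption; lra|].
  intros x Hx eps Heps.
  (* By the lower bound on [V], a value below [m] forces the norm below [eps]. *)
  set (m := C1 * rpow eps a).
  assert (Hm : 0 < m) by (apply Rmult_lt_0_compat; [exact HC1 | apply rpow_gt0, Heps]).
  set (M := C2 * rpow e0 b).
  assert (HM : 0 < M) by (apply Rmult_lt_0_compat; [exact HC2 | apply rpow_gt0, He0]).
  (* By the upper bound on [V], a value of at least [m] keeps the norm at least [nu]; [del] is the
     decay rate that the gradient condition then guarantees. *)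
  set (nu := rpow (m / C2) (/ b)).
  assert (HmC : 0 < m / C2) by (apply Rdiv_lt_0_compat; assumption).
  assert (Hnu : 0 < nu) by (apply rpow_gt0, HmC).
  set (del := C3 / Gamma alpha * rpow nu c).
  assert (Hdelp : 0 < del).
  { apply Rmult_lt_0_compat; [apply Rdiv_lt_0_compat; assumption | apply rpow_gt0, Hnu]. }
  set (K := M * (alpha / (1 - alpha) + 2)).
  assert (HK : 0 < K).
  { apply Rmult_lt_0_compat; [exact HM|].
    assert (0 < alpha / (1 - alpha)) by (apply Rdiv_lt_0_compat; lra). lra. }
  (* [K * kap] is half of [del / alpha], which makes the smallness condition of [lyapunov_decay]
     strict, and [y0] solves [y0^(-alpha) = kap]. Since [y0] involves no time, it is itself the
     threshold after which the solution is small. *)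
  set (kap := del / alpha / K / 2).
  assert (Hkap : 0 < kap) by (repeat apply Rdiv_lt_0_compat; lra).
  set (y0 := Rpower kap (- / alpha)).
  assert (Hy0 : Rpower y0 (- alpha) = kap).
  { unfold y0. rewrite Rpower_mult.
    replace (- / alpha * - alpha) with 1 by (field; lra). apply Rpower_1, Hkap. }
  exists y0. intros t Ht.
  assert (Hy0pos : 0 < y0) by apply Rpower_gt0.
  pose proof (Hx (t + 1) ltac:(lra)) as Hsol.
  assert (Hball : forall s, norm (x (clamp 0 t s)) < e0).
  { intros s. pose proof (clamp_range 0 t s ltac:(lra)).
    apply (Hsol_ball e0 x0 (t + 1) x); try assumption; lra. }
  assert (Hct : clamp 0 t t = t) by (apply clamp_id; lra).
  assert (Hvt : V (x (clamp 0 t t)) < m).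
  { apply (lyapunov_decay d alpha V (fun s => x (clamp 0 t s))
       (fun s => F (x (clamp 0 t s))) t y0 M m del); try assumption; try lra.
    - apply (solution_clamp_vcontinuity d alpha D f x0 (t + 1) x t Hsol); lra.
    - apply (vcontinuity_vlipschitz d L' F _ HL' HF).
      apply (solution_clamp_vcontinuity d alpha D f x0 (t + 1) x t Hsol); lra.
    - apply (solution_clamp_equation d alpha D f x0 (t + 1) x t t q L'); try assumption; try lra.
      intros s _. specialize (Hball s). lra.
    - intros s. split; [apply HVpos|]. specialize (Hball s).
      eapply Rle_trans; [apply HVb; lra|].
      apply Rmult_le_compat_l; [lra|]. apply rpow_le; lra.
    - intros s p _ Hms Hp. specialize (Hball s).
      eapply Rle_trans; [apply HgradF; [lra | exact Hp]|].
      apply Ropp_le_contravar, Rmult_le_compat_l; [apply Rdiv_le_0_compat; lra|].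
      apply rpow_le; [lra|]. unfold nu.
      rewrite <- (rpow_inv (norm (x (clamp 0 t s))) b) by (try apply norm_ge0; lra).
      apply rpow_le; [apply Rinv_0_lt_compat, Hb|].
      apply Rmult_le_reg_l with C2; [exact HC2|].
      replace (C2 * (m / C2)) with m by (field; lra).
      eapply Rle_trans; [exact Hms|]. apply HVb. lra.
    - rewrite Hy0.
      replace (M * kap * (alpha / (1 - alpha) + 2)) with (K * kap) by (unfold K; ring).
      replace (K * kap) with (del / alpha / 2) by (unfold kap; field; lra).
      assert (0 < del / alpha) by (apply Rdiv_lt_0_compat; lra). lra. }
  specialize (Hball t). rewrite Hct in Hvt, Hball.
  apply Rnot_le_lt. intros Hc.
  destruct (HVb (x t) ltac:(lra)) as [Hlow _].
  assert (rpow eps a <= rpow (norm (x t)) a) by (apply rpow_le; assumption).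
  assert (m <= C1 * rpow (norm (x t)) a) by (apply Rmult_le_compat_l; lra).
  lra.
Qed.
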